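(* Consider the periodic initial boundary value problem $$u_{xt}+uu_{xx}-\lambda u_x^2=I(t),\quad u(x,0)=u_0(x),\quad I(t)=-(\lambda+1)\int_0^1u_x^2\,dx,\quad u(0,t)=u(1,t),\ u_x(0,t)=u_x(1,t),$$ for $x\in[0,1]$, $t>0$, where, for some $q>0$ and $C_2>0$, $u_0'(\alpha)\sim m_0+C_2|\alpha-\underline\alpha_j|^q$ near every $\underline\alpha_j$. Then: 1. Suppose $\lambda\in[-1,0)$ and $q>0$. Then there exists a finite $t_*>0$ such that only the minimum diverges, $m(t)\to-\infty$, as $t\uparrow t_*$ (one-sided, discrete blow-up). 2. Suppose $\lambda<-1$ and $q\in(0,1)$ satisfy $\lambda\ne\frac{q}{1-nq}$ and $q\ne\frac1n$ for all $n\in\mathbb{N}$. Then a one-sided, discrete blow-up, as described in part 1, occurs in finite time. The same holds for $\frac{q}{1-q}<\lambda<-1$ and $q>1$. 3. Suppose $\lambda<\frac{q}{1-q}$ and $q>1$. Then there is a finite $t_*>0$ such that $M(t)\to+\infty$ and $m(t)\to-\infty$ as $t\uparrow t_*$. Moreover, $\lim_{t\uparrow t_*}u_x(\gamma(\alpha,t),t)=+\infty$ for $\alpha\notin\bigcup_{i,j}\{\overline\alpha_i\}\cup\{\underline\alpha_j\}$ (two-sided, everywhere blow-up). Finally, for $\lambda<0$, $q>0$ and $t_*>0$ as in the parts above, the jacobian satisfies $$\lim_{t\uparrow t_*}\gamma_\alpha(\alpha,t)=\begin{cases}0,&\alpha=\underline\alpha_j,\\C(\alpha),&\alpha\neq\underline\alpha_j,\end{cases}$$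 where $C(\alpha)\in(0,\infty)$ depends on the choice of $\lambda$, $q$ and $\alpha\ne\underline\alpha_j$.
   Context: $\mathbb{N}=\{1,2,\dots\}$. ''$\alpha=\underline\alpha_j$'' means $\alpha$ is one of the points $\underline\alpha_j$, and ''$\alpha\neq\underline\alpha_j$'' that it is none of them. Standing assumptions on the data: $u_0$ is periodic, $u_0'$ is bounded and at least continuous a.e. on $(0,1)$ (so $\int_0^1u_0'=0$); $M_0>0>m_0$ are the greatest and least values of $u_0'$, attained at finitely many points $\overline\alpha_i$ and $\underline\alpha_j$ of $[0,1]$ respectively (and $u_0'$ is bounded away from these values off any neighbourhood of these points). Neighbourhoods are periodic. $u_0'(\alpha)\sim m_0+C_2|\alpha-\underline\alpha_j|^q$ near $\underline\alpha_j$ means $u_0'(\alpha)-m_0$ is asymptotically equivalent (ratio $\to1$) to $C_2|\alpha-\underline\alpha_j|^q$ as $\alpha\to\underline\alpha_j$. Solutions are understood along characteristics $\gamma$, $\dot\gamma(\alpha,t)=u(\gamma(\alpha,t),t)$, $\gamma(\alpha,0)=\alpha$. For $\lambda<0$ put $\mathcal{J}(\alpha,t)=1-\lambda\eta(t)u_0'(\alpha)$, $\bar{\mathcal{K}}_i(t)=\int_0^1\mathcal{J}(\alpha,t)^{-i-1/\lambda}d\alpha$, where $\dot\eta=\bar{\mathcal{K}}_0^{-2\lambda}$, $\eta(0)=0$. The solution is given by $$\gamma_\alpha=\frac{\mathcal{J}(\alpha,t)^{-1/\lambda}}{\bar{\mathcal{K}}_0(t)},\qquad u_x(\gamma(\alpha,t),t)=\frac{1}{\lambda\eta(t)\bar{\mathcal{K}}_0(t)^{2\lambda}}\left(\frac{1}{\mathcal{J}(\alpha,t)}-\frac{\bar{\mathcal{K}}_1(t)}{\bar{\mathcal{K}}_0(t)}\right)$$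 (with value $u_0'(\alpha)$ at $t=0$) as long as $\eta(t)<\eta_*=\frac1{\lambda m_0}$, and is defined for $t\in[0,t_* )$ with $$t_*=\lim_{\eta\uparrow\eta_*}\int_0^\eta\left(\int_0^1(1-\lambda\mu u_0'(\alpha))^{-1/\lambda}d\alpha\right)^{2\lambda}d\mu.$$ $M(t)=\sup_\alpha u_x(\gamma(\alpha,t),t)$ and $m(t)=\inf_\alpha u_x(\gamma(\alpha,t),t)$; one has $M(t)=u_x(\gamma(\overline\alpha_i,t),t)$, $m(t)=u_x(\gamma(\underline\alpha_j,t),t)$. ''Only the minimum diverges'' (one-sided, discrete blow-up) means that divergence occurs (to $-\infty$) only at the finitely many labels $\alpha=\underline\alpha_j$, while $u_x(\gamma(\alpha,t),t)$ stays bounded as $t\uparrow t_*$ for every other $\alpha$ and $M(t)$ does not diverge. *)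

(* Defs.v *)
From HB Require Import structures.
From mathcomp Require Import all_boot all_order all_algebra.
From mathcomp Require Import all_classical all_reals all_analysis.

Set Implicit Arguments.
Unset Strict Implicit.
Unset Printing Implicit Defensive.

Import Order.TTheory GRing.Theory Num.Theory.
Import numFieldNormedType.Exports.

Local Open Scope classical_set_scope.
Local Open Scope ring_scope.

(* The labels in [0, 1] at which the initial slope takes the value c.  The
   points bar(alpha)_i are [level_points du0 M0], the points
   underline(alpha)_j are [level_points du0 m0]. *)
Definition level_points (R : realType) (du0 : R -> R) (c : R) : set R :=
  [set a | 0 <= a <= 1 /\ du0 a = c].

(* Periodic functions on [0, 1] are extended to R with period 1, so that
   neighbourhoods of the end points are periodic.  u0' is a given function
   [du0] of which u0 is a primitive: it need only be continuous a.e., and at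
   its discontinuities its value need not be a classical derivative of u0. *)
Record initial_data (R : realType) (u0 du0 : R -> R) (M0 m0 : R) : Prop := {
  u0_periodic : forall x : R, u0 (x + 1) = u0 x;
  du0_periodic : forall x : R, du0 (x + 1) = du0 x;
  u0_primitive : forall x : R, 0 <= x <= 1 ->
    u0 x = u0 0 + \int[lebesgue_measure]_(y in `[0, x]) du0 y;
  du0_ae_continuous :
    {ae lebesgue_measure, forall x : R, x \in `]0, 1[ -> {for x, continuous du0}};
  extrema_sign : m0 < 0 < M0;
  du0_bounds : forall x : R, m0 <= du0 x <= M0;
  max_attained : level_points du0 M0 !=set0;
  max_finite : finite_set (level_points du0 M0);
  min_attained : level_points du0 m0 !=set0;
  min_finite : finite_set (level_points du0 m0);
  (* 0 and 1 lie in [level_points] simultaneously, so on [0, 1] the distance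
     to these sets need not be taken periodically. *)
  max_isolated : forall e : R, 0 < e -> exists2 d : R, 0 < d &
    forall x : R, 0 <= x <= 1 ->
      (forall a : R, level_points du0 M0 a -> e <= `|x - a|) -> du0 x <= M0 - d;
  min_isolated : forall e : R, 0 < e -> exists2 d : R, 0 < d &
    forall x : R, 0 <= x <= 1 ->
      (forall a : R, level_points du0 m0 a -> e <= `|x - a|) -> m0 + d <= du0 x
}.

(* u0'(alpha) ~ m0 + C2 |alpha - a|^q as alpha -> a. *)
Definition power_min_at (R : realType) (du0 : R -> R) (m0 C2 q a : R) : Prop :=
  (du0 x - m0) / (C2 * `|x - a| `^ q) @[x --> a^'] --> (1 : R).

(* J and K_i depend on t through e = eta(t) only. *)
Definition calJ (R : realType) (lambda : R) (du0 : R -> R) (e alpha : R) : R :=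
  1 - lambda * e * du0 alpha.

Definition Kbar (R : realType) (lambda : R) (du0 : R -> R) (i : nat) (e : R) : R :=
  \int[lebesgue_measure]_(alpha in `[0, 1])
    (calJ lambda du0 e alpha `^ (- i%:R - lambda^-1)).

Definition eta_star (R : realType) (lambda m0 : R) : R := (lambda * m0)^-1.

(* T is the (finite) value of t_*. *)
Definition blowup_time (R : realType) (lambda : R) (du0 : R -> R) (m0 T : R) : Prop :=
  \int[lebesgue_measure]_(mu in `[0, e]) (Kbar lambda du0 0 mu `^ (2 * lambda))
    @[e --> (eta_star lambda m0)^'-] --> T.

(* A solution on [0, T) understood along characteristics.  Spatial derivatives
   are densities of absolutely continuous functions, as for u0'. *)
Record char_solution (R : realType) (lambda : R) (u0 du0 : R -> R) (m0 T : R) :=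
  CharSolution {
  u : R -> R -> R;
  ux : R -> R -> R;
  gam : R -> R -> R;
  gam_alpha : R -> R -> R;
  eta : R -> R;
  (* boundary and initial conditions *)
  u_periodic : forall (x t : R), 0 <= t < T -> u (x + 1) t = u x t;
  ux_periodic : forall (x t : R), 0 <= t < T -> ux (x + 1) t = ux x t;
  u_init : forall x : R, u x 0 = u0 x;
  u_primitive : forall (x t : R), 0 <= x <= 1 -> 0 <= t < T ->
    u x t = u 0 t + \int[lebesgue_measure]_(y in `[0, x]) ux y t;
  (* characteristics *)
  gam_init : forall alpha : R, gam alpha 0 = alpha;
  gam_cont0 : forall alpha : R, gam alpha t @[t --> (0 : R)^'+] --> alpha;
  gam_ode : forall (alpha t : R), 0 < t < T ->
    is_derive t (1 : R) (gam alpha) (u (gam alpha t) t);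
  gam_periodic : forall (alpha t : R), 0 <= t < T ->
    gam (alpha + 1) t = gam alpha t + 1;
  gam_primitive : forall (alpha t : R), 0 <= alpha <= 1 -> 0 <= t < T ->
    gam alpha t = gam 0 t + \int[lebesgue_measure]_(a in `[0, alpha]) gam_alpha a t;
  (* u_xt + u u_xx - lambda u_x^2 = I(t): the first two terms are the time
     derivative of u_x along a characteristic *)
  ux_pde : forall (alpha t : R), 0 < t < T ->
    is_derive t (1 : R) (fun s => ux (gam alpha s) s)
      (lambda * ux (gam alpha t) t ^+ 2
       - (lambda + 1) * \int[lebesgue_measure]_(x in `[0, 1]) (ux x t ^+ 2));
  (* the representation formulae *)
  eta_init : eta 0 = 0;
  eta_cont0 : eta t @[t --> (0 : R)^'+] --> (0 : R);
  eta_ode : forall t : R, 0 < t < T ->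
    is_derive t (1 : R) eta (Kbar lambda du0 0 (eta t) `^ (- (2 * lambda)));
  eta_lt : forall t : R, 0 <= t < T -> eta t < eta_star lambda m0;
  gam_alphaE : forall (alpha t : R), 0 <= t < T ->
    gam_alpha alpha t =
      calJ lambda du0 (eta t) alpha `^ (- lambda^-1) / Kbar lambda du0 0 (eta t);
  ux_gam0 : forall alpha : R, ux (gam alpha 0) 0 = du0 alpha;
  ux_gamE : forall (alpha t : R), 0 < t < T ->
    ux (gam alpha t) t =
      (lambda * eta t * Kbar lambda du0 0 (eta t) `^ (2 * lambda))^-1 *
      ((calJ lambda du0 (eta t) alpha)^-1
       - Kbar lambda du0 1 (eta t) / Kbar lambda du0 0 (eta t))
}.

Section Extrema.
Variables (R : realType) (lambda : R) (u0 du0 : R -> R) (m0 T : R).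
Variable s : char_solution lambda u0 du0 m0 T.

Definition Mmax (t : R) : R :=
  sup [set ux s (gam s alpha t) t | alpha in `[0, 1]%classic].

Definition mmin (t : R) : R :=
  inf [set ux s (gam s alpha t) t | alpha in `[0, 1]%classic].

Definition one_sided_discrete_blowup : Prop :=
  [/\ mmin t @[t --> T^'-] --> -oo,
      forall alpha : R, level_points du0 m0 alpha ->
        ux s (gam s alpha t) t @[t --> T^'-] --> -oo,
      forall alpha : R, 0 <= alpha <= 1 -> ~ level_points du0 m0 alpha ->
        bounded_near (fun t : R => ux s (gam s alpha t) t) (T^'-) &
      bounded_near Mmax (T^'-)].

Definition two_sided_everywhere_blowup (M0 : R) : Prop :=
  [/\ Mmax t @[t --> T^'-] --> +oo,
      mmin t @[t --> T^'-] --> -oo &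
      forall alpha : R, 0 <= alpha <= 1 ->
        ~ level_points du0 M0 alpha -> ~ level_points du0 m0 alpha ->
        ux s (gam s alpha t) t @[t --> T^'-] --> +oo].

Definition jacobian_limit : Prop :=
  forall alpha : R, 0 <= alpha <= 1 ->
    (level_points du0 m0 alpha ->
       gam_alpha s alpha t @[t --> T^'-] --> (0 : R)) /\
    (~ level_points du0 m0 alpha ->
       exists2 C : R, 0 < C & gam_alpha s alpha t @[t --> T^'-] --> C).

End Extrema.

(* The parameter ranges of the three parts; part 2 has two. *)
Definition part1_range (R : realType) (lambda q : R) : Prop :=
  -1 <= lambda < 0 /\ 0 < q.

Definition part2_range (R : realType) (lambda q : R) : Prop :=
  [/\ lambda < -1, 0 < q < 1 &
      forall n : nat, (0 < n)%N ->
        lambda != q / (1 - n%:R * q) /\ q != n%:R^-1].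

Definition part2_range_large_q (R : realType) (lambda q : R) : Prop :=
  q / (1 - q) < lambda < -1 /\ 1 < q.

Definition part3_range (R : realType) (lambda q : R) : Prop :=
  lambda < q / (1 - q) /\ 1 < q.

(* Main.v *)
Require Import Defs.
From mathcomp Require Import all_boot all_order all_algebra.
From mathcomp Require Import all_classical all_reals all_analysis.
From mathcomp Require Import measurable_realfun ring lra.
Set Implicit Arguments.
Unset Strict Implicit.
Import Order.TTheory GRing.Theory Num.Theory.
Import numFieldNormedType.Exports.
Local Open Scope classical_set_scope.
Local Open Scope ring_scope.

(** Put p = -1/lambda > 0 and eps = 1 - eta/eta_star.  Since J is affine in eta,
    it interpolates between 1 and its terminal value Jstar = (u0' - m0)/(-m0):
    J = eps + (1 - eps) Jstar.  Hence J lies between eps and a constant, and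
    stays away from 0 at every label where u0' > m0.  The behaviour of u_x and
    of gamma_alpha along a characteristic is then read off from the explicit
    formulae, as limits for eta -> eta_star, once the moments
    K_0 = int J^p and K_1 = int J^(p-1) are understood.

    - K_0 is continuous up to eta_star, with a positive limit ([Kbar0_cvg],
      [Kbar0_gt0]), because p > 0.
    - eps K_1 -> 0 always ([eps_Kbar1_cvg]): J >= eps gives
      J^(p-1) <= C + eps^(p-1).  At a minimum J = eps, so in
      1/J - K_1/K_0 the first term dominates and u_x -> -oo there.
    - K_1 stays bounded if p >= 1, or if p < 1 and q(1 - p) < 1: in the second
      case J^(p-1) is at most a constant times the sum over the minima a of
      (s + |x - a|)^(-q(1-p)) with s = eps^(1/q), whose integral is bounded
      uniformly in s ([Kbar1_le_small_p]).  Then u_x is bounded at all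
      other labels: this is the one-sided blow-up.
    - K_1 -> +oo if p < 1 and q(1 - p) > 1: on [a, a + s] one has J <= C eps, so
      that K_1 >= C' eps^(p-1+1/q) ([Kbar1_cvgy]).  Then u_x -> +oo at all
      labels that are not minima: this is the two-sided blow-up.

    In terms of lambda, p >= 1 says that -1 <= lambda < 0.  For lambda < -1,
    q(1 - p) < 1 holds if q < 1, and if q > 1 then 1 - q(1 - p) has the sign of
    lambda - q/(1 - q).

    To pass from eta to t: F(e) = int_0^e K_0^(2 lambda) satisfies
    F(eta(t)) = t by the equation for eta, and T = F(eta_star), so that
    eta(t) -> eta_star as t -> T ([eta_cvg_left]).

    As u0' is continuous only almost everywhere, it need not be Borel
    measurable.  The integral of an arbitrary nonnegative function being the
    supremum of the integrals of the simple functions below it, null sets can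
    nevertheless be discarded ([integral_null_subset]), and all integrals are
    taken over a set of full measure on which u0' is measurable and exceeds its
    minimum ([good_labels]). *)

(** * Discarding null sets for arbitrary integrands *)
Section null_sets.
Context d (T : measurableType d) (R : realType).
Variable mu : {measure set T -> \bar R}.
Import HBNNSimple.
Local Open Scope ereal_scope.

(** Restricting a simple function below f to the complement of N does not
    change its integral and puts it below g. *)
Lemma le_ge0_integral_null (N : set T) (f g : T -> \bar R) :
  measurable N -> mu N = 0 ->
  (forall x, 0 <= f x) -> (forall x, 0 <= g x) ->
  (forall x, ~ N x -> f x <= g x) ->
  \int[mu]_x f x <= \int[mu]_x g x.
Proof.
move=> mN N0 f0 g0 fg.
rewrite ge0_integralTE// ge0_integralTE//.
apply: ge_ereal_sup => _ [h /= hf <-].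
have mNC : measurable (~` N) by exact: measurableC.
pose k := proj_nnsfun h mNC.
have kE x : k x = (h x * \1_(~` N) x)%R by [].
apply: (@le_trans _ _ (sintegral mu k)); last first.
  apply: ereal_sup_ubound; exists k => // x.
  rewrite kE indicE; have [Nx|Nx] := boolP (x \in ~` N).
    by rewrite mulr1 (le_trans (hf x))// fg//; exact/set_mem.
  by rewrite mulr0.
rewrite -2!integralT_nnsfun.
apply: ae_ge0_le_integral => //.
- by move=> x _; rewrite lee_fin.
- by apply/measurable_EFinP.
- by move=> x _; rewrite lee_fin.
- by apply/measurable_EFinP.
exists N; split => // x; apply: contra_notP => Nx _.
by rewrite kE indicE mem_set// mulr1.
Qed.

Lemma eq_integral_null (N : set T) (f g : T -> \bar R) :
  measurable N -> mu N = 0 ->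
  (forall x, ~ N x -> f x = g x) ->
  \int[mu]_x f x = \int[mu]_x g x.
Proof.
move=> mN N0 fg; rewrite integralE [RHS]integralE; congr (_ - _).
  by apply/eqP; rewrite eq_le; apply/andP; split;
    apply: (le_ge0_integral_null mN N0) => // x /fg; rewrite !funeposE => ->.
by apply/eqP; rewrite eq_le; apply/andP; split;
  apply: (le_ge0_integral_null mN N0) => // x /fg; rewrite !funenegE => ->.
Qed.

Lemma integral_null_subset (D E N : set T) (f : T -> \bar R) :
  measurable N -> mu N = 0 -> E `<=` D -> D `\` E `<=` N ->
  \int[mu]_(x in D) f x = \int[mu]_(x in E) f x.
Proof.
move=> mN N0 ED DEN; rewrite integral_mkcond [RHS]integral_mkcond.
apply: (eq_integral_null mN N0) => x Nx; rewrite !patchE.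
have [xE|xE] := boolP (x \in E).
  by rewrite mem_set//; apply: ED; exact/set_mem.
case: ifPn => // xD; exfalso; apply/Nx/DEN; split; first exact/set_mem.
by move/negP: xE; apply: contra_not => /mem_set.
Qed.
End null_sets.

(** * Real powers *)
Section powers.
Context (R : realType).

Lemma powR_cvg (y b : R) : 0 < y -> x `^ b @[x --> y] --> y `^ b.
Proof.
move=> y0; suff : {for y, continuous (fun x : R => x `^ b)} by [].
apply: differentiable_continuous; apply/derivable1_diffP.
by apply: derivable_powR; rewrite in_itv/= y0.
Qed.

(** Truncation at 0 matters: [powR] takes the value 1 at negative bases. *)
Lemma max0_powR_continuous (p : R) : 0 < p ->
  continuous (fun y : R => Num.max y 0 `^ p).
Proof.
move=> p0 y; have [y0|y0|->] := ltgtP y 0.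
- rewrite /continuous_at max_r ?(ltW y0)//.
  apply: cvg_near_cst; near=> z; rewrite /= max_r// ltW//.
  by near: z; exact: lt_nbhsl.
- rewrite /continuous_at max_l ?(ltW y0)//.
  apply: (@cvg_trans _ (x `^ p @[x --> y])); last exact: powR_cvg.
  apply: near_eq_cvg; near=> z; rewrite /= max_l// ltW//.
  by near: z; exact: lt_nbhsr.
- rewrite /continuous_at maxxx powR0 ?gt_eqF//.
  apply/cvgrPdist_lt => e e0.
  have e1 : 0 < e `^ p^-1 by rewrite powR_gt0.
  near=> z; rewrite sub0r normrN ger0_norm ?powR_ge0//.
  have : Num.max z 0 < e `^ p^-1.
    rewrite gt_max e1 andbT; near: z; exact: (lt_nbhsl e1).
  move=> /(gt0_ltr_powR p0); rewrite !nnegrE le_max lexx orbT powR_ge0.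
  move=> /(_ isT isT) /lt_le_trans; apply.
  by rewrite -powRrM mulVf ?gt_eqF// powRr1// ltW.
Unshelve. all: by end_near. Qed.

(** The condition s * s = 1 covers both slopes 1 and -1, that is, both sides of
    a singularity. *)
Lemma is_derive_powR_affine (c s r x : R) : s * s = 1 -> r != 1 ->
  0 < c + s * x ->
  is_derive x 1 (fun x => s * (c + s * x) `^ (1 - r) / (1 - r)) ((c + s * x) `^ (- r)).
Proof.
move=> ss r1 cx.
have h : is_derive x 1 (fun x : R => (c + s * x) `^ (1 - r))
   (((1 - r) * (c + s * x) `^ (1 - r - 1)) * s).
  apply: (@is_derive1_comp _ (fun y => y `^ (1 - r)) (fun x => c + s * x)).
    exact: is_derive1_powR.
  have hd := is_deriveD (is_derive_cst c x (1 : R)) (is_deriveZ s (is_derive_id x (1 : R))).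
  have e1 : cst c + s \*: id = (fun x => c + s * x) by apply/funext.
  by rewrite e1 in hd; apply: (is_derive_eq hd); rewrite add0r /GRing.scale/= mulr1.
have h2 := is_deriveZ (s / (1 - r)) h.
rewrite (_ : (fun x => _) =
    (s / (1 - r)) \*: (fun x : R => (c + s * x) `^ (1 - r))); last first.
  by apply/funext => z /=; rewrite /GRing.scale/= mulrAC.
apply: (is_derive_eq h2).
rewrite /GRing.scale/=.
have -> : 1 - r - 1 = - r by ring.
rewrite [LHS](_ : _ =
  (s * s) * ((1 - r) / (1 - r)) * (c + s * x) `^ (- r)); last by ring.
by rewrite ss mulfV ?subr_eq0 1?eq_sym// !mul1r.
Qed.

Lemma integral_powR_affine (c s r a b : R) : s * s = 1 -> r != 1 -> a < b ->
  (forall x, a <= x <= b -> 0 < c + s * x) ->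
  \int[lebesgue_measure]_(x in `[a, b]) (c + s * x) `^ (- r) =
  s * (c + s * b) `^ (1 - r) / (1 - r) - s * (c + s * a) `^ (1 - r) / (1 - r).
Proof.
move=> ss r1 ab pos.
pose F x := s * (c + s * x) `^ (1 - r) / (1 - r).
have der x : a <= x <= b -> is_derive x 1 F ((c + s * x) `^ (- r)).
  by move=> /pos; exact: is_derive_powR_affine.
have cF x : a <= x <= b -> {for x, continuous F}.
  move=> /der[d _]; apply: differentiable_continuous; exact/derivable1_diffP.
rewrite /Rintegral (continuous_FTC2 (F := F))//.
- apply: continuous_in_subspaceT => x; rewrite inE/= in_itv/= => xab.
  apply: (@continuous_comp _ _ _ (fun x => c + s * x) (fun y => y `^ (- r))).
    apply: continuousD; first exact: cvg_cst.
    apply: continuousM; [exact: cvg_cst|exact: cvg_id].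
  exact/powR_cvg/pos.
- split.
  + move=> x; rewrite in_itv/= => /andP[ax xb].
    by have [] := der x _; rewrite ?(ltW ax) ?(ltW xb).
  + by apply: cvg_at_right_filter; apply: cF; rewrite lexx ltW.
  + by apply: cvg_at_left_filter; apply: cF; rewrite lexx ltW.
- move=> x; rewrite in_itv/= => /andP[ax xb]; rewrite derive1E.
  have [_ ->//] : is_derive x 1 F ((c + s * x) `^ (- r)).
  by apply: der; rewrite !ltW.
Qed.
End powers.

(** * Integrals of regularized powers of the distance to a point *)
Section distance_integral.
Context (R : realType).
Local Notation mu := (@lebesgue_measure R).

Lemma integral_powR_affine_le (c s r a b : R) : s * s = 1 -> 0 < r < 1 -> a < b ->
  (forall x, a <= x <= b -> 0 < c + s * x <= 2) ->
  \int[mu]_(x in `[a, b]) (c + s * x) `^ (- r) <= 2 / (1 - r).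
Proof.
move=> ss /andP[r0 r1] ab pos.
have r1' : 0 < 1 - r by rewrite subr_gt0.
rewrite integral_powR_affine//; last 2 first.
- by rewrite lt_eqF.
- by move=> x /pos/andP[].
rewrite -mulrBl ler_wpM2r// ?invr_ge0 ?(ltW r1')//.
have bnd x : a <= x <= b -> 0 <= (c + s * x) `^ (1 - r) <= 2.
  move=> /pos/andP[c0 c2]; rewrite powR_ge0/=.
  apply: (@le_trans _ _ (2 `^ (1 - r))).
    by apply: (ge0_ler_powR (ltW r1')) => //; rewrite nnegrE// ltW.
  by apply: ler1_powR; [rewrite ler1n|rewrite gerBl ltW].
have /andP[a0 a2] := bnd a (introT andP (conj (lexx _) (ltW ab))).
have /andP[b0 b2] := bnd b (introT andP (conj (ltW ab) (lexx _))).
have : s = 1 \/ s = -1.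
  have : (s - 1) * (s + 1) = s * s - 1 by ring.
  rewrite ss subrr => /eqP; rewrite mulf_eq0 subr_eq0 addr_eq0.
  by case/orP=> /eqP ->; [left|right].
move=> s1.
have aux X Y : 0 <= X -> X <= 2 -> 0 <= Y -> Y <= 2 -> s * Y - s * X <= 2.
  by case: s1 => ->; lra.
exact: aux.
Qed.

Lemma dist_powR_continuous (s r a : R) : 0 < s ->
  continuous (fun x : R => (s + `|x - a|) `^ (- r)).
Proof.
move=> s0 x; apply: (@continuous_comp _ _ _ (fun x => s + `|x - a|) (fun y => y `^ (- r))).
  apply: continuousD; first exact: cvg_cst.
  apply: (@continuous_comp _ _ _ (fun x => x - a) (fun y => `|y|)).
    apply: continuousB; [exact: cvg_id|exact: cvg_cst].
  exact: norm_continuous.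
by apply: powR_cvg; rewrite ltr_wpDr.
Qed.

(** The shift by s makes the integrand continuous, and the bound does not depend
    on s since r < 1; on each side of a the antiderivative is explicit. *)
Lemma integral_dist_powR_le (s r a : R) : 0 < r < 1 -> 0 < s <= 1 -> 0 <= a <= 1 ->
  \int[mu]_(x in `[0, 1]) (s + `|x - a|) `^ (- r) <= 4 / (1 - r).
Proof.
move=> r01 /andP[s0 s1] /andP[a0 a1].
have r1' : 0 < 1 - r by rewrite subr_gt0; case/andP: r01.
pose f x := (s + `|x - a|) `^ (- r).
have itf (c d : R) : mu.-integrable `[c, d] (EFin \o f).
  apply: continuous_compact_integrable; first exact: segment_compact.
  by apply: continuous_subspaceT; exact: dist_powR_continuous.
have split1 : \int[mu]_(x in `[0, 1]) f x =
    \int[mu]_(x in `[0, a]) f x + \int[mu]_(x in `[a, 1]) f x.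
  have := Rintegral_itvB (itf 0 1) (_ : BLeft 0 <= BRight a)%O (_ : BRight a <= BRight 1)%O.
  rewrite !bnd_simp => /(_ a0 a1).
  rewrite Rintegral_itv_obnd_cbnd; first by move=> <-; rewrite addrC subrK.
  by apply: integrableS (itf a 1) => //; apply: subset_itvr; rewrite bnd_simp.
rewrite split1 (_ : 4 / (1 - r) = 2 / (1 - r) + 2 / (1 - r)); last by rewrite -mulrDl -natrD.
have r2 : 0 <= 2 / (1 - r) by rewrite divr_ge0// ltW.
apply: lerD.
- move: a0; rewrite le_eqVlt => /predU1P[<-|a0].
    by rewrite set_itv1 Rintegral_set1.
  rewrite (@eq_Rintegral _ (measurableTypeR R) R _ _ (fun x : R => (s + a + (-1) * x) `^ (- r))).
    apply: integral_powR_affine_le => //; first by rewrite mulrNN mulr1.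
    by move=> x /andP[x0 xa]; apply/andP; split; lra.
  move=> x; rewrite inE/= in_itv/= => /andP[x0 xa].
  by rewrite /f distrC ger0_norm ?subr_ge0//; congr (_ `^ _); ring.
- move: a1; rewrite le_eqVlt => /predU1P[->|a1].
    by rewrite set_itv1 Rintegral_set1.
  rewrite (@eq_Rintegral _ (measurableTypeR R) R _ _ (fun x : R => (s - a + 1 * x) `^ (- r))).
    apply: integral_powR_affine_le => //; first by rewrite mulr1.
    by move=> x /andP[x0 xa]; apply/andP; split; lra.
  move=> x; rewrite inE/= in_itv/= => /andP[x0 xa].
  by rewrite /f ger0_norm ?subr_ge0//; congr (_ `^ _); ring.
Qed.

Lemma integral_sum_dist_powR_le (s r : R) (pts : seq R) :
  0 < r < 1 -> 0 < s <= 1 -> (forall a, a \in pts -> 0 <= a <= 1) ->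
  (\int[mu]_(x in `[0%R, 1%R]) (\sum_(a <- pts) ((s + `|x - a|) `^ (- r))%:E)
    <= ((size pts)%:R * (4 / (1 - r)))%:E)%E.
Proof.
move=> r01 s01 pts01; have s0 : 0 < s by case/andP: s01.
rewrite ge0_integral_sum//; last 2 first.
- move=> a; apply/measurable_EFinP; apply: measurable_funTS.
  by apply: continuous_measurable_fun; exact: dist_powR_continuous.
- by move=> a x _; rewrite lee_fin powR_ge0.
rewrite (@le_trans _ _ (\sum_(a <- pts) (4 / (1 - r))%:E)%E)//.
  rewrite big_seq [leRHS]big_seq; apply: lee_sum => a /pts01 a01.
  have := integral_dist_powR_le r01 s01 a01; rewrite -lee_fin.
  rewrite fineK//; apply: integrable_fin_num => //.
  apply: (@continuous_compact_integrable _ (fun x => (s + `|x - a|) `^ (- r))).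
    exact: segment_compact.
  by apply: continuous_subspaceT; exact: dist_powR_continuous.
by rewrite sumEFin lee_fin big_const_seq count_predT iter_addr addr0 -[leLHS]mulr_natl.
Qed.
End distance_integral.

(** * A set of full measure on which the initial slope is measurable *)
Section good_labels.
Context (R : realType).
Local Notation mu := (@lebesgue_measure R).

(** On the complement of the null set of discontinuities the restriction of u0'
    is continuous, hence Borel measurable.  The minima and the end points are
    removed as well; they form a finite set. *)
Lemma good_labels (u0 du0 : R -> R) (M0 m0 : R) : initial_data u0 du0 M0 m0 ->
  exists E : set R, [/\ measurable E, E `<=` `[0, 1],
    measurable_fun E du0, (forall x, E x -> m0 < du0 x) &
    forall f : R -> \bar R,
      (\int[mu]_(x in `[0%R, 1%R]) f x = \int[mu]_(x in E) f x)%E].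
Proof.
move=> H; have [N [mN N0 Nsub]] := du0_ae_continuous H.
pose L := level_points du0 m0 `|` [set 0; 1].
have cL : countable L.
  apply: finite_set_countable; rewrite finite_setU; split; first exact: min_finite H.
  exact: finite_set2.
have mL : measurable L by apply: countable_measurable => //.
exists (`]0, 1[ `\` (N `|` L)); split.
- by apply: measurableD => //; exact: measurableU.
- by move=> x [/= + _]; exact: subset_itv_oo_cc.
- apply: subspace_continuous_measurable_fun.
    by apply: measurableD => //; exact: measurableU.
  apply: continuous_in_subspaceT => x /set_mem[x01 NL].
  apply: contrapT => nc; apply: NL; left; apply: Nsub => /= /(_ _).
  by move/(_ x01).
- move=> x [/= x01 NL]; have /andP[h _] := du0_bounds H x.
  rewrite lt_neqAle h andbT; apply/eqP => e; apply: NL; right; left; split => //.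
  by move: x01; rewrite in_itv/= => /andP[? ?]; rewrite !ltW.
- move=> f; apply: (@integral_null_subset _ _ _ mu _ _ (N `|` L)) => //.
  + exact: measurableU.
  + by rewrite measureU0//; exact: countable_lebesgue_measure0.
  + by move=> x [/= + _]; exact: subset_itv_oo_cc.
  + move=> x [/= x01]; apply: contra_notP => NL; split => //=.
    move: x01; rewrite !in_itv/= => /andP[x0 x1]; rewrite !lt_neqAle x0 x1 !andbT.
    by apply/andP; split; apply/eqP => e; apply: NL; right; right; rewrite -e /=; [left|right].
Qed.

End good_labels.

(** * Bounds on the factor J *)
Lemma le_convex (R : realFieldType) (r a b k : R) : 0 <= r <= 1 ->
  k <= a -> k <= b -> k <= (1 - r) * a + r * b.
Proof.
move=> /andP[r0 r1] ka kb.
have -> : k = (1 - r) * k + r * k by ring.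
by rewrite lerD// ler_wpM2l// subr_ge0.
Qed.

Section jacobian.
Context (R : realType) (lambda m0 M0 : R) (du0 : R -> R).
Hypotheses (lam0 : lambda < 0) (m00 : m0 < 0) (M00 : 0 < M0).
Hypothesis bnd : forall x, m0 <= du0 x <= M0.
Local Notation es := (eta_star lambda m0).
Local Notation J := (calJ lambda du0).
Local Notation p := (- lambda^-1).

Implicit Types e x : R.

Lemma eta_star_gt0 : 0 < es.
Proof. by rewrite /eta_star invr_gt0 nmulr_rgt0. Qed.

Lemma p_gt0 : 0 < p.
Proof. by rewrite oppr_gt0 invr_lt0. Qed.

Lemma calJ_star x : J es x = (du0 x - m0) / - m0.
Proof. by rewrite /calJ /eta_star; field; rewrite ?lt_eqF. Qed.

(** J is affine in e, equal to 1 at e = 0. *)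
Lemma calJ_interp e x : J e x = (1 - e / es) + (e / es) * J es x.
Proof. by rewrite /calJ /eta_star; field; rewrite ?lt_eqF. Qed.

(** The terminal value of J at a maximum of u0'; it bounds J from above. *)
Definition Jtop : R := (M0 - m0) / - m0.

Lemma Jtop_ge1 : 1 <= Jtop.
Proof. by rewrite /Jtop ler_pdivlMr ?oppr_gt0// mul1r lerDr ltW. Qed.

Lemma calJ_star_ge0 x : 0 <= J es x.
Proof.
by rewrite calJ_star divr_ge0// ?subr_ge0 ?oppr_ge0 ?(ltW m00)//; case/andP: (bnd x).
Qed.

Lemma calJ_star_top x : J es x <= Jtop.
Proof.
rewrite calJ_star ler_pM2r ?invr_gt0 ?oppr_gt0// lerD2r.
by case/andP: (bnd x).
Qed.

Lemma ratio_in01 e : 0 <= e <= es -> 0 <= e / es <= 1.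
Proof.
have := eta_star_gt0 => es0 /andP[e0 ee].
by rewrite divr_ge0 ?(ltW es0)// ler_pdivrMr// mul1r.
Qed.

Lemma calJ_ge_eps e x : 0 <= e <= es -> 1 - e / es <= J e x.
Proof.
move=> /ratio_in01/andP[h0 h1]; rewrite calJ_interp lerDl mulr_ge0//.
exact: calJ_star_ge0.
Qed.

Lemma calJ_ge_min e x : 0 <= e <= es -> Num.min 1 (J es x) <= J e x.
Proof.
move=> /ratio_in01/andP[h0 h1]; rewrite (calJ_interp e).
rewrite -[1 - e / es]mulr1; apply: le_convex; rewrite ?h0//.
  by rewrite ge_min lexx.
by rewrite ge_min lexx orbT.
Qed.

Lemma calJ_ge0 e x : 0 <= e <= es -> 0 <= J e x.
Proof.
move=> h; apply: le_trans (calJ_ge_min x h).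
by rewrite le_min ler01 calJ_star_ge0.
Qed.

Lemma calJ_top e x : 0 <= e <= es -> J e x <= Jtop.
Proof.
move=> /ratio_in01/andP[h0 h1]; rewrite calJ_interp.
rewrite -lerN2 opprD -[X in _ <= _ + X]mulrN -[- (1 - _)]mulrN1.
by apply: le_convex; rewrite ?h0// lerN2 ?Jtop_ge1// calJ_star_top.
Qed.

Lemma eps_gt0 e : 0 <= e < es -> 0 < 1 - e / es.
Proof.
by move=> /andP[e0 ee]; rewrite subr_gt0 ltr_pdivrMr ?mul1r ?eta_star_gt0.
Qed.

Lemma calJ_gt0 e x : 0 <= e < es -> 0 < J e x.
Proof.
move=> h; apply: (lt_le_trans (eps_gt0 h)); apply: calJ_ge_eps.
by case/andP: h => -> /ltW ->.
Qed.

Lemma calJ_min e x : du0 x = m0 -> J e x = 1 - e / es.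
Proof. by move=> h; rewrite calJ_interp calJ_star h subrr mul0r mulr0 addr0. Qed.
End jacobian.

(** * The moments of J *)
Section moments.
Context (R : realType) (lambda m0 M0 : R) (du0 : R -> R) (E : set R).
Hypotheses (lam0 : lambda < 0) (m00 : m0 < 0) (M00 : 0 < M0).
Hypothesis bnd : forall x, m0 <= du0 x <= M0.
Local Notation mu := (@lebesgue_measure R).
Hypothesis mE : measurable E.
Hypothesis mdu : measurable_fun E du0.
Hypothesis Egt : forall x, E x -> m0 < du0 x.
Hypothesis EI : forall f : R -> \bar R,
  (\int[mu]_(x in `[0%R, 1%R]) f x = \int[mu]_(x in E) f x)%E.
Local Notation es := (eta_star lambda m0).
Local Notation J := (calJ lambda du0).
Local Notation p := (- lambda^-1).
Local Notation Jtop := (Jtop m0 M0).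
Implicit Types e x b : R.

Lemma measure_good_labels : mu E = 1%E.
Proof.
have := EI (cst 1%E); rewrite !integral_cst//= !mul1e => <-.
by rewrite lebesgue_measure_itv/= lte01 oppr0 adde0.
Qed.

Lemma Kbar_good i e : Kbar lambda du0 i e =
  \int[mu]_(x in E) (J e x `^ (- i%:R - lambda^-1)).
Proof. by rewrite /Kbar /Rintegral EI. Qed.

Lemma integrable_bounded (f : R -> R) (C : R) : measurable_fun E f ->
  (forall x, E x -> `|f x| <= C) -> mu.-integrable E (EFin \o f).
Proof.
move=> mf fC; apply: measurable_bounded_integrable => //.
  by have h : (mu E < +oo)%E by rewrite measure_good_labels ltry.
exists C; split; first exact: num_real.
by move=> x Cx y Ey; apply: le_trans (ltW Cx); exact: fC.
Qed.

Lemma measurable_calJ e : measurable_fun E (J e).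
Proof.
apply: measurable_funB; first exact: measurable_cst.
by apply: measurable_funM => //; exact: measurable_cst.
Qed.

Lemma measurable_calJ_powR e b : measurable_fun E (fun x => J e x `^ b).
Proof.
apply: (@measurableT_comp _ _ _ _ _ _ (fun y : R => y `^ b)).
  exact: measurable_powR.
exact: measurable_calJ.
Qed.

Lemma Rintegral_le_cst (f : R -> R) (C : R) : measurable_fun E f ->
  (forall x, E x -> 0 <= f x <= C) -> \int[mu]_(x in E) f x <= C.
Proof.
move=> mf fC.
have -> : C = \int[mu]_(x in E) (cst C x).
  by rewrite Rintegral_cst//= measure_good_labels mulr1.
apply: le_Rintegral => //.
- by apply: (@integrable_bounded _ C) => // x /fC/andP[f0 fC']; rewrite ger0_norm.
- by apply: (@integrable_bounded _ `|C|) => //.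
- by move=> x /fC/andP[].
Qed.

(** J is at least the smaller of its values at e = 0 and e = [eta_star], so this
    is a lower bound for all the integrals [Kbar] of index 0. *)
Definition Kmin : R := \int[mu]_(x in E) (Num.min 1 (J es x) `^ p).

Lemma measurable_Kmin : measurable_fun E (fun x => Num.min 1 (J es x) `^ p).
Proof.
apply: (@measurableT_comp _ _ _ _ _ _ (fun y : R => y `^ p)); first exact: measurable_powR.
apply: (@measurable_minr _ _ _ E (cst 1)); first exact: measurable_cst.
exact: measurable_calJ.
Qed.

Let min01 x : 0 <= Num.min 1 (J es x) <= 1.
Proof. by rewrite le_min ler01 (calJ_star_ge0 lam0 m00 bnd) ge_min lexx. Qed.

Let p0 : 0 < p. Proof. exact: p_gt0. Qed.

Let minp x : 0 <= Num.min 1 (J es x) `^ p <= 1.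
Proof.
rewrite powR_ge0/=; have /andP[h0 h1] := min01 x.
by rewrite (le_trans (ge0_ler_powR (ltW p0) _ _ h1)) ?nnegrE ?powR1.
Qed.

Lemma integrable_Kmin : mu.-integrable E (EFin \o (fun x => Num.min 1 (J es x) `^ p)).
Proof.
apply: (@integrable_bounded _ 1); first exact: measurable_Kmin.
by move=> x _; rewrite ger0_norm ?powR_ge0//; case/andP: (minp x).
Qed.

(** The integrand is positive everywhere on the set E of measure 1. *)
Lemma Kmin_gt0 : 0 < Kmin.
Proof.
rewrite lt_neqAle Rintegral_ge0 ?andbT; last by move=> x _; exact: powR_ge0.
apply/eqP => K0.
pose f (x : R) : R := Num.min 1 (J es x) `^ p.
have f0 : (\int[mu]_(x in E) `|(f x)%:E| = 0)%E.
  rewrite (@eq_integral _ _ _ mu E (EFin \o f)); last first.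
    by move=> x _; rewrite /= ger0_norm ?powR_ge0.
  have fn : (\int[mu]_(x in E) (EFin \o f) x)%E \is a fin_num.
    by apply: integrable_fin_num => //; exact: integrable_Kmin.
  by rewrite -(fineK fn); congr EFin; exact: esym K0.
have [|N [mN N0 EN]] := (@ae_eq_integral_abs _ _ _ mu _ mE (EFin \o f) _).1 f0.
  by apply/measurable_EFinP; exact: measurable_Kmin.
have : (mu E <= mu N)%E.
  apply: le_measure; rewrite ?inE// => x Ex; apply: EN => /= /(_ Ex) [].
  apply/eqP; rewrite powR_eq0 negb_and; apply/orP; left.
  rewrite gt_eqF// lt_min ltr01/= (calJ_star _ lam0 m00) divr_gt0// ?oppr_gt0// subr_gt0.
  exact: Egt.
by rewrite N0 measure_good_labels lee_fin ler10.
Qed.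

Lemma calJ_powR_le e x : 0 <= e <= es -> 0 <= J e x `^ p <= Jtop `^ p.
Proof.
move=> h; rewrite powR_ge0/=; apply: ge0_ler_powR; first exact: ltW.
- by rewrite nnegrE (calJ_ge0 lam0 m00 bnd).
- by rewrite nnegrE (le_trans ler01)// (Jtop_ge1 m00 M00).
- exact: (calJ_top lam0 m00 M00 bnd).
Qed.

Lemma Kbar0E e : Kbar lambda du0 0 e = \int[mu]_(x in E) (J e x `^ p).
Proof. by rewrite Kbar_good; under eq_Rintegral do rewrite oppr0 add0r. Qed.

Lemma Kbar1E e : Kbar lambda du0 1 e = \int[mu]_(x in E) (J e x `^ (p - 1)).
Proof. by rewrite Kbar_good; under eq_Rintegral do rewrite addrC. Qed.

Lemma Kbar0_ge e : 0 <= e <= es -> Kmin <= Kbar lambda du0 0 e.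
Proof.
move=> h; rewrite Kbar0E; apply: le_Rintegral => //.
- exact: integrable_Kmin.
- apply: (@integrable_bounded _ (Jtop `^ p)); first exact: measurable_calJ_powR.
  by move=> x _; rewrite ger0_norm ?powR_ge0//; case/andP: (calJ_powR_le x h).
- move=> x _; apply: ge0_ler_powR; first exact: ltW.
  + by rewrite nnegrE; case/andP: (min01 x).
  + by rewrite nnegrE (calJ_ge0 lam0 m00 bnd).
  + exact: (calJ_ge_min _ lam0 m00 x h).
Qed.

Lemma Kbar0_le e : 0 <= e <= es -> Kbar lambda du0 0 e <= Jtop `^ p.
Proof.
move=> h; rewrite Kbar0E; apply: Rintegral_le_cst.
  exact: measurable_calJ_powR.
by move=> x _; exact: calJ_powR_le.
Qed.

Lemma Kbar0_gt0 e : 0 <= e <= es -> 0 < Kbar lambda du0 0 e.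
Proof. by move=> /Kbar0_ge; exact/lt_le_trans/Kmin_gt0. Qed.

(** Truncating J at 0 extends the integral continuously in e to all of R, which
    turns continuity at the end points 0 and [eta_star] into plain continuity. *)
Definition Kext e : R := \int[mu]_(x in E) (Num.max (J e x) 0 `^ p).

Lemma Kext_eq e : 0 <= e <= es -> Kext e = Kbar lambda du0 0 e.
Proof.
move=> h; rewrite Kbar0E; apply: eq_Rintegral => x _.
by rewrite max_l// (calJ_ge0 lam0 m00 bnd).
Qed.

(** Dominated convergence, with a constant bound near e. *)
Lemma Kext_continuous : continuous Kext.
Proof.
move=> e; pose u := e - 1; pose v := e + 1.
pose B := 1 + (`|lambda| * (`|e| + 1)) * (M0 - m0).
have Jbnd e' x : e' \in `]u, v[ -> `|Num.max (J e' x) 0| <= B.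
  rewrite in_itv/= => /andP[ue ev].
  have e'e : `|e'| <= `|e| + 1.
    rewrite (_ : e' = e + (e' - e)); last by ring.
    apply: (le_trans (ler_normD _ _)); rewrite lerD2l ler_norml.
    by move: ue ev; rewrite /u /v => ue ev; apply/andP; split; lra.
  have B0 : 0 <= B.
    have Mm0 : 0 <= M0 - m0 by rewrite subr_ge0 ltW// (lt_trans m00).
    by rewrite addr_ge0// mulr_ge0// mulr_ge0// addr_ge0.
  rewrite ger0_norm ?le_max ?lexx ?orbT// ge_max B0 andbT.
  apply: (le_trans (ler_norm _)); apply: (le_trans (ler_normB _ _)).
  rewrite normr1 lerD2l !normrM; apply: ler_pM => //.
    by rewrite ler_wpM2l.
  by have := bnd x; rewrite ler_norml => /andP[? ?]; apply/andP; split; move: m00 M00; lra.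
have mK e' : measurable_fun E (fun x => Num.max (J e' x) 0 `^ p).
  apply: (@measurableT_comp _ _ _ _ _ _ (fun y : R => y `^ p)); first exact: measurable_powR.
  apply: (@measurable_maxr _ _ _ E _ (cst 0)); last exact: measurable_cst.
  exact: measurable_calJ.
have pbnd e' x : e' \in `]u, v[ -> `|Num.max (J e' x) 0 `^ p| <= B `^ p.
  move=> /(@Jbnd _ x); rewrite ger0_norm; last by rewrite le_max lexx orbT.
  move=> h; rewrite ger0_norm ?powR_ge0//.
  have h0 : 0 <= Num.max (J e' x) 0 by rewrite le_max lexx orbT.
  by apply: ge0_ler_powR => //; rewrite ?nnegrE ?(ltW p0)// (le_trans h0).
apply: (@continuity_under_integral _ _ _ mu _ _ mE u v _ _ (cst (B `^ p))).
- by move=> e' /= euv; apply: (@integrable_bounded _ (B `^ p)) => // x _; exact: pbnd.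
- apply: aeW => x Ex e' _.
  apply: (@continuous_comp _ _ _ (fun e' => J e' x) (fun y => Num.max y 0 `^ p)).
    apply: continuousB; first exact: cvg_cst.
    apply: continuousM; last exact: cvg_cst.
    by apply: continuousM; [exact: cvg_cst|exact: cvg_id].
  exact: max0_powR_continuous.
- by apply: (@integrable_bounded _ (B `^ p)) => // x _; rewrite /= ger0_norm ?powR_ge0.
- by move=> e' /= euv; apply: aeW => x Ex; exact: pbnd.
- by rewrite inE/= in_itv/=; apply/andP; split; rewrite /u /v; lra.
Qed.

Lemma Kbar0_cvg : Kbar lambda du0 0 e @[e --> es^'-] --> Kbar lambda du0 0 es.
Proof.
have es0 := eta_star_gt0 lam0 m00.
rewrite -Kext_eq ?lexx ?(ltW es0)//.
apply: (@cvg_trans _ (Kext e @[e --> es^'-])); last first.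
  by apply: cvg_at_left_filter; exact: Kext_continuous.
apply: near_eq_cvg; near=> e; rewrite Kext_eq//.
by apply/andP; split; [near: e; exact: nbhs_left_ge|near: e; exact: nbhs_left_le].
Unshelve. all: by end_near. Qed.

Lemma Kbar1_ge0 e : 0 <= Kbar lambda du0 1 e.
Proof. by apply: Rintegral_ge0 => x _; exact: powR_ge0. Qed.

(** One summand for each sign of p - 1, according to whether J^(p-1) increases
    or decreases with J. *)
Lemma calJ_powR_pred_le e x : 0 <= e < es ->
  J e x `^ (p - 1) <= Jtop `^ (p - 1) + (1 - e / es) `^ (p - 1).
Proof.
move=> h; have h' : 0 <= e <= es by case/andP: h => -> /ltW.
have J0 := calJ_gt0 lam0 m00 bnd x h.
have [p1|p1] := leP 0 (p - 1).
  rewrite -[leLHS]addr0 lerD ?powR_ge0//; apply: ge0_ler_powR => //.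
  - by rewrite nnegrE ltW.
  - by rewrite nnegrE (le_trans ler01)// (Jtop_ge1 m00 M00).
  - exact: (calJ_top lam0 m00 M00 bnd).
rewrite -[leLHS]add0r lerD ?powR_ge0// -(opprK (p - 1)) powRN [leRHS]powRN.
have e0 := eps_gt0 lam0 m00 h.
rewrite lef_pV2 ?posrE ?powR_gt0//; apply: ge0_ler_powR => //.
- by rewrite oppr_ge0 ltW.
- by rewrite nnegrE ltW.
- by rewrite nnegrE ltW.
- exact: (calJ_ge_eps lam0 m00 bnd).
Qed.

Lemma Kbar1_le e : 0 <= e < es ->
  Kbar lambda du0 1 e <= Jtop `^ (p - 1) + (1 - e / es) `^ (p - 1).
Proof.
move=> h; rewrite Kbar1E; apply: Rintegral_le_cst.
  exact: measurable_calJ_powR.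
by move=> x _; rewrite powR_ge0 calJ_powR_pred_le.
Qed.

Lemma integrable_calJ_powR_pred e : 0 <= e < es ->
  mu.-integrable E (EFin \o (fun x => J e x `^ (p - 1))).
Proof.
move=> h; apply: (@integrable_bounded _ (Jtop `^ (p - 1) + (1 - e / es) `^ (p - 1))).
  exact: measurable_calJ_powR.
by move=> x _; rewrite ger0_norm ?powR_ge0// calJ_powR_pred_le.
Qed.

Lemma eps_cvg : (1 - e / es) @[e --> es^'-] --> (0 : R)^'+.
Proof.
have es0 := eta_star_gt0 lam0 m00.
have h : (1 - e / es) @[e --> es^'-] --> 0.
  have -> : 0 = 1 - es / es by rewrite divff ?subrr ?gt_eqF.
  apply: cvg_at_left_filter; apply: cvgB; first exact: cvg_cst.
  by apply: cvgMl; exact: cvg_id.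
move=> A A0; have := h _ A0; rewrite /nbhs /= => hh.
near=> e; suff : 1 - e / es > 0 by near: e.
rewrite eps_gt0//; apply/andP; split; first by near: e; exact: nbhs_left_ge.
by near: e; exact: nbhs_left_lt.
Unshelve. all: by end_near. Qed.

(** By the previous bound, eps K_1 <= C eps + eps^p.  This holds whether or not
    K_1 diverges, and makes the term 1/J = 1/eps dominant at a minimum. *)
Lemma eps_Kbar1_cvg : ((1 - e / es) * Kbar lambda du0 1 e) @[e --> es^'-] --> 0.
Proof.
apply: (@squeeze_cvgr _ _ _ _ (cst 0)
  (fun e => (1 - e / es) * Jtop `^ (p - 1) + (1 - e / es) `^ p)).
- near=> e.
  have h : 0 <= e < es.
    apply/andP; split; first by near: e; apply: nbhs_left_ge; exact: eta_star_gt0.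
    by near: e; exact: nbhs_left_lt.
  have e0 := eps_gt0 lam0 m00 h.
  rewrite mulr_ge0 ?Kbar1_ge0 ?(ltW e0)//= -(mulr_powRB1 (ltW e0) p0) -mulrDr.
  by rewrite ler_wpM2l ?(ltW e0)// Kbar1_le.
- exact: cvg_cst.
- have -> : 0 = 0 * Jtop `^ (p - 1) + 0 by rewrite mul0r addr0.
  apply: cvgD.
    by apply: cvgMl; apply: cvg_trans eps_cvg _; exact: cvg_within.
  exact: (cvg_comp _ _ eps_cvg (powR_cvg0 p0)).
Unshelve. all: by end_near. Qed.

Lemma Kbar1_le_large_p e : 1 <= p -> 0 <= e < es ->
  Kbar lambda du0 1 e <= Jtop `^ (p - 1).
Proof.
move=> p1 h; have h' : 0 <= e <= es by case/andP: h => -> /ltW.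
rewrite Kbar1E; apply: Rintegral_le_cst; first exact: measurable_calJ_powR.
move=> x _; rewrite powR_ge0/=; apply: ge0_ler_powR; first by rewrite subr_ge0.
- by rewrite nnegrE (calJ_ge0 lam0 m00 bnd).
- by rewrite nnegrE (le_trans ler01)// (Jtop_ge1 m00 M00).
- exact: (calJ_top lam0 m00 M00 bnd).
Qed.

End moments.

(** * Behaviour of the moment of index 1, according to the order of the minima *)
Section minima.
Context (R : realType) (lambda q C2 m0 M0 : R) (du0 : R -> R) (E : set R).
Hypotheses (lam0 : lambda < 0) (m00 : m0 < 0) (M00 : 0 < M0).
Hypotheses (q0 : 0 < q) (C20 : 0 < C2).
Hypothesis bnd : forall x, m0 <= du0 x <= M0.
Local Notation mu := (@lebesgue_measure R).
Hypothesis mE : measurable E.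
Hypothesis E01 : E `<=` `[0, 1].
Hypothesis mdu : measurable_fun E du0.
Hypothesis EI : forall f : R -> \bar R,
  (\int[mu]_(x in `[0%R, 1%R]) f x = \int[mu]_(x in E) f x)%E.
Hypothesis Lfin : finite_set (level_points du0 m0).
Hypothesis Lex : level_points du0 m0 !=set0.
Hypothesis Liso : forall e : R, 0 < e -> exists2 d : R, 0 < d &
    forall x : R, 0 <= x <= 1 ->
      (forall a : R, level_points du0 m0 a -> e <= `|x - a|) -> m0 + d <= du0 x.
Hypothesis Lmin : forall a, level_points du0 m0 a -> power_min_at du0 m0 C2 q a.
Local Notation es := (eta_star lambda m0).
Local Notation J := (calJ lambda du0).
Local Notation p := (- lambda^-1).
Implicit Types (e x a : R).

Lemma power_min_near a : level_points du0 m0 a -> exists2 d : R, 0 < d &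
  forall x, `|x - a| < d ->
    C2 / 2 * `|x - a| `^ q <= du0 x - m0 <= 2 * C2 * `|x - a| `^ q.
Proof.
move=> La; have /cvgrPdist_lt/(_ (2^-1)) := Lmin La.
rewrite invr_gt0 ltr0n => /(_ isT) [d /= d0 H]; exists d => // x xad.
have [->|xa] := eqVneq x a.
  by case: La => _ ->; rewrite !subrr normr0 powR0 ?gt_eqF// !mulr0 lexx.
have := H x; rewrite /ball_ /= distrC => /(_ xad xa).
have y0 : 0 < `|x - a| `^ q by rewrite powR_gt0// normr_gt0 subr_eq0.
have z0 : 0 < C2 * `|x - a| `^ q by rewrite mulr_gt0.
rewrite ltr_norml => /andP[h1 h2].
have {}h1 : (du0 x - m0) / (C2 * `|x - a| `^ q) < 2 by lra.
have {}h2 : 2^-1 < (du0 x - m0) / (C2 * `|x - a| `^ q) by lra.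
rewrite ltr_pdivrMr// in h1; rewrite ltr_pdivlMr// in h2.
by apply/andP; split; lra.
Qed.

Lemma common_radius (pts : seq R) (P : R -> R -> Prop) :
  (forall a, a \in pts -> exists2 d : R, 0 < d & forall x, `|x - a| < d -> P a x) ->
  exists2 d : R, 0 < d & forall a x, a \in pts -> `|x - a| < d -> P a x.
Proof.
elim: pts => [_|a pts IH H]; first by exists 1.
have [|d1 d10 H1] := IH; first by move=> b bp; apply: H; rewrite in_cons bp orbT.
have [|d2 d20 H2] := H a; first by rewrite mem_head.
exists (Num.min d1 d2); first by rewrite lt_min d10.
move=> b x; rewrite in_cons lt_min => /predU1P[->|bp] /andP[h1 h2].
  exact: H2.
exact: H1.
Qed.

(** Close to a minimum this is the asymptotic equivalence; away from all minima
    u0' - m0 is bounded below, while any distance in [0, 1] is at most 1. *)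
Lemma power_lower_bound : exists2 c : R, 0 < c & forall x, 0 <= x <= 1 ->
  exists2 a, level_points du0 m0 a & c * `|x - a| `^ q <= du0 x - m0.
Proof.
have /finite_seqP[pts ptsE] := Lfin.
have mem a : a \in pts <-> level_points du0 m0 a by rewrite ptsE.
have [|d d0 H] := @common_radius pts (fun a x => C2 / 2 * `|x - a| `^ q <= du0 x - m0).
  move=> a /mem/power_min_near[d d0 H]; exists d => // x /H/andP[]//.
have [k k0 Hk] := Liso d0.
exists (Num.min (C2 / 2) k); first by rewrite lt_min k0 divr_gt0.
move=> x x01.
have [[a La ad]|far] :=
  pselect (exists2 a, level_points du0 m0 a & `|x - a| < d).
  exists a => //; apply: le_trans (H a x _ ad); last exact/mem.
  by rewrite ler_wpM2r ?powR_ge0// ge_min lexx.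
have [a La] := Lex; exists a => //.
apply: (@le_trans _ _ k).
  rewrite -[leRHS]mulr1; apply: ler_pM; rewrite ?powR_ge0//.
  - by rewrite le_min (ltW k0) divr_ge0// ltW.
  - by rewrite ge_min lexx orbT.
  - rewrite (le_trans (ge0_ler_powR (ltW q0) _ _ (_ : `|x - a| <= 1))) ?nnegrE ?powR1//.
    case: La => /andP[a0 a1] _; case/andP: x01 => x0 x1.
    by rewrite ler_norml; apply/andP; split; lra.
rewrite lerBrDl; apply: Hk => // b Lb; rewrite leNgt; apply/negP => bd.
by apply: far; exists b.
Qed.

(** The shift eps^(1/q) has q-th power eps, so that eps + |x - a|^q is comparable
    to the q-th power of the shifted distance, by
    (s + y)^q <= 2^q (s^q + y^q).  From e >= [eta_star]/2 the weight of the terminal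
    value in J is at least 1/2. *)
Lemma calJ_lower : exists2 c : R, 0 < c & forall e x, es / 2 <= e < es ->
  0 <= x <= 1 -> exists2 a, level_points du0 m0 a &
  c * ((1 - e / es) `^ q^-1 + `|x - a|) `^ q <= J e x.
Proof.
have es0 := eta_star_gt0 lam0 m00.
have [c c0 H] := power_lower_bound.
pose c1 := Num.min 1 (c / (2 * - m0)).
have c10 : 0 < c1 by rewrite lt_min ltr01 divr_gt0// mulr_gt0// oppr_gt0.
exists (c1 / 2 `^ q); first by rewrite divr_gt0// powR_gt0.
move=> e x /andP[e1 e2] /H[a La Ha]; exists a => //.
have e0 : 0 <= e by apply: le_trans e1; rewrite divr_ge0// ltW.
have eps0 : 0 < 1 - e / es by apply: (eps_gt0 lam0 m00); rewrite e0.
set eps := 1 - e / es in eps0 *; set y := `|x - a|; set s := eps `^ q^-1.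
have y0 : 0 <= y by exact: normr_ge0.
have s0 : 0 <= s by exact: powR_ge0.
have sq : s `^ q = eps by rewrite -powRrM mulVf ?gt_eqF// powRr1// ltW.
have sy : (s + y) `^ q <= 2 `^ q * (eps + y `^ q).
  apply: (@le_trans _ _ ((2 * Num.max s y) `^ q)).
    apply: ge0_ler_powR; rewrite ?nnegrE ?(ltW q0) ?addr_ge0//.
      by rewrite mulr_ge0// le_max s0.
    by rewrite mulr_natl mulr2n lerD// le_max lexx ?orbT.
  rewrite powRM// ?le_max ?s0// ler_wpM2l ?powR_ge0// -sq.
  by have [_|_] := leP s y; rewrite ?lerDl ?lerDr powR_ge0.
apply: (@le_trans _ _ (c1 * (eps + y `^ q))).
  by rewrite -mulrA ler_wpM2l ?(ltW c10)// mulrC ler_pdivrMr ?powR_gt0// mulrC.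
rewrite (calJ_interp _ lam0 m00) -/eps mulrDr lerD//.
  by rewrite -[leRHS]mul1r ler_wpM2r ?(ltW eps0)// ge_min lexx.
rewrite (calJ_star _ lam0 m00).
apply: (@le_trans _ _ (2^-1 * ((c * y `^ q) / - m0))).
  have -> : 2^-1 * ((c * y `^ q) / - m0) = c / (2 * - m0) * y `^ q.
    by field; rewrite lt_eqF.
  by rewrite ler_wpM2r ?powR_ge0// ge_min lexx orbT.
apply: ler_pM => //.
- by rewrite divr_ge0// ?oppr_ge0 ?(ltW m00)// mulr_ge0 ?powR_ge0// ltW.
- by rewrite ler_pdivlMr// mulrC.
- by rewrite ler_wpM2r// invr_ge0 oppr_ge0 ltW.
Qed.

(** Summing over all minima avoids choosing the one that controls J at x. *)
Lemma Kbar1_le_small_p : p < 1 -> q * (1 - p) < 1 ->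
  exists C : R, forall e, es / 2 <= e < es -> Kbar lambda du0 1 e <= C.
Proof.
move=> p1 qp1; have es0 := eta_star_gt0 lam0 m00.
have /finite_seqP[pts ptsE] := Lfin.
have mem a : a \in pts <-> level_points du0 m0 a by rewrite ptsE.
have [c c0 H] := calJ_lower.
pose r := q * (1 - p).
have r01 : 0 < r < 1 by rewrite qp1 mulr_gt0// subr_gt0.
exists (c `^ (p - 1) * ((size pts)%:R * (4 / (1 - r)))) => e e12.
have e0s : 0 <= e < es.
  by case/andP: e12 => h ->; rewrite andbT (le_trans _ h)// divr_ge0// ltW.
have eps0 := eps_gt0 lam0 m00 e0s.
set s := (1 - e / es) `^ q^-1 in H *.
have s0 : 0 < s by rewrite powR_gt0.
have s1 : s <= 1.
  rewrite (le_trans (ge0_ler_powR _ _ _ (_ : _ <= 1))) ?nnegrE ?powR1 ?(ltW eps0)//.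
    by rewrite invr_ge0 ltW.
  by rewrite gerBl divr_ge0 ?(ltW es0)//; case/andP: e0s.
pose F x : \bar R := (\sum_(a <- pts) ((s + `|x - a|) `^ (- r))%:E)%E.
have mdist a : measurable_fun [set: R] (fun x => ((s + `|x - a|) `^ (- r))%:E).
  apply/measurable_EFinP; apply: continuous_measurable_fun.
  exact: dist_powR_continuous.
have mF : measurable_fun [set: R] F by apply: emeasurable_sum => a _; exact: mdist.
have F0 x : (0 <= F x)%E by apply: sume_ge0 => a _; rewrite lee_fin powR_ge0.
rewrite (Kbar1E lambda du0 EI) -lee_fin fineK; last first.
  apply: integrable_fin_num => //.
  exact: (integrable_calJ_powR_pred lam0 m00 M00 bnd mE mdu EI e0s).
apply: (@le_trans _ _ (\int[mu]_(x in E) ((c `^ (p - 1))%:E * F x))%E).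
  apply: ge0_le_integral => //.
  - by move=> x _; rewrite lee_fin powR_ge0.
  - by apply/measurable_EFinP; exact: measurable_calJ_powR.
  - by apply: measurable_funeM; exact: measurable_funTS.
  move=> x /E01; rewrite /= in_itv/= => /(H e x e12)[a /mem Ha aJ].
  apply: (@le_trans _ _ ((c `^ (p - 1))%:E * ((s + `|x - a|) `^ (- r))%:E)%E).
    rewrite -EFinM lee_fin.
    have sx0 : 0 < s + `|x - a| by rewrite ltr_wpDr.
    have -> : (s + `|x - a|) `^ (- r) = ((s + `|x - a|) `^ q) `^ (p - 1).
      by rewrite -powRrM; congr (_ `^ _); rewrite /r; ring.
    have J0 := calJ_gt0 lam0 m00 bnd x e0s.
    rewrite -powRM ?(ltW c0) ?powR_ge0// -(opprK (p - 1)) powRN [leRHS]powRN.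
    have cs0 : 0 < c * (s + `|x - a|) `^ q by rewrite mulr_gt0// powR_gt0.
    rewrite lef_pV2 ?posrE ?powR_gt0//.
    by apply: ge0_ler_powR => //; rewrite ?nnegrE ?oppr_ge0 ?subr_le0 ltW.
  rewrite lee_wpmul2l ?lee_fin ?powR_ge0// /F (big_rem a)//=.
  by rewrite leeDl// sume_ge0// => b _; rewrite lee_fin powR_ge0.
rewrite ge0_integralZl_EFin ?powR_ge0//; last exact: measurable_funTS.
rewrite [leRHS]EFinM lee_wpmul2l ?lee_fin ?powR_ge0// -EI.
apply: integral_sum_dist_powR_le; rewrite ?s0//.
by move=> a /mem[].
Qed.

Lemma calJ_upper a : level_points du0 m0 a -> exists c d : R, [/\ 0 < c, 0 < d &
  forall e x, 0 <= e <= es -> `|x - a| < d ->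
  J e x <= (1 - e / es) + c * `|x - a| `^ q].
Proof.
move=> /power_min_near[d d0 H]; exists (2 * C2 / - m0), d; split => //.
  by rewrite divr_gt0 ?mulr_gt0// oppr_gt0.
move=> e x /(ratio_in01 lam0 m00)/andP[r0 r1] /H/andP[_ h].
rewrite (calJ_interp _ lam0 m00) lerD2l.
have j0 := calJ_star_ge0 lam0 m00 bnd x.
apply: (@le_trans _ _ (J es x)); first by rewrite -[leRHS]mul1r ler_wpM2r.
by rewrite (calJ_star _ lam0 m00) mulrAC ler_wpM2r// invr_ge0 oppr_ge0 ltW.
Qed.

(** The integral over [a, a + s] alone; its measure is read off through the
    invariance of integrals under passing from [0, 1] to E. *)
Lemma Kbar1_lower a (s B e : R) : p < 1 -> 0 <= e < es -> 0 <= a -> 0 < s -> a + s <= 1 ->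
  (forall x, a <= x <= a + s -> J e x <= B) ->
  B `^ (p - 1) * s <= Kbar lambda du0 1 e.
Proof.
move=> p1 e0s a0 s0 as1 JB.
rewrite (Kbar1E lambda du0 EI) -lee_fin fineK; last first.
  apply: integrable_fin_num => //.
  exact: (integrable_calJ_powR_pred lam0 m00 M00 bnd mE mdu EI e0s).
pose I : set R := `[a, a + s]%classic.
have mI : measurable I by exact: measurable_itv.
have I01 : I `&` `[0%R, 1%R] = I.
  apply/seteqP; split; first by move=> x [].
  move=> x Ix; split => //; move: Ix; rewrite /I /= !in_itv/= => /andP[h1 h2].
  by rewrite (le_trans a0)// (le_trans h2).
have muI : (\int[mu]_(x in E) (\1_I x)%:E = s%:E)%E.
  rewrite -EI integral_indic//= I01 lebesgue_measure_itv/= lte_fin ltrDl s0.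
  by rewrite -EFinB addrAC subrr add0r.
rewrite EFinM -muI -ge0_integralZl_EFin ?powR_ge0//; last first.
  by apply/measurable_EFinP; exact: measurable_indic.
apply: ge0_le_integral => //.
- by move=> x _; rewrite mule_ge0// lee_fin ?powR_ge0.
- by apply: measurable_funeM; apply/measurable_EFinP; exact: measurable_indic.
- by apply/measurable_EFinP; exact: measurable_calJ_powR.
move=> x _; rewrite -EFinM lee_fin indicE.
have [|xI] := boolP (x \in I); last by rewrite mulr0 powR_ge0.
rewrite inE /I /= in_itv/= => /JB h; rewrite mulr1.
have J0 := calJ_gt0 lam0 m00 bnd x e0s.
rewrite -(opprK (p - 1)) powRN [leRHS]powRN.
have B0 := lt_le_trans J0 h.
rewrite lef_pV2 ?posrE ?powR_gt0//.
by apply: ge0_ler_powR => //; rewrite ?nnegrE ?oppr_ge0 ?subr_le0 ltW.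
Qed.

(** With s = eps^(1/q) one has J <= (1 + c) eps on [a, a + s], so that K_1 is at
    least a constant times eps^(p - 1 + 1/q), a negative power of eps.  The interval
    lies in [0, 1] for small eps because a < 1. *)
Lemma Kbar1_cvgy a : level_points du0 m0 a -> a < 1 -> p < 1 -> 1 < q * (1 - p) ->
  Kbar lambda du0 1 e @[e --> es^'-] --> +oo.
Proof.
move=> La a1 p1 qp1; have es0 := eta_star_gt0 lam0 m00.
have [c [d [c0 d0 H]]] := calJ_upper La.
pose b := 1 - p - q^-1.
have b0 : 0 < b.
  by rewrite /b subr_gt0 -[ltLHS]mulr1 ltr_pdivrMl.
have epsc := eps_cvg lam0 m00.
have eps0 : (1 - e / es) @[e --> es^'-] --> 0.
  by apply: cvg_trans epsc _; exact: cvg_within.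
apply: (@ger_cvgy _ _ _ _ (fun e => (1 + c) `^ (p - 1) * ((1 - e / es) `^ b)^-1)).
- near=> e.
  have e0s : 0 <= e < es.
    by apply/andP; split; near: e; [exact: nbhs_left_ge|exact: nbhs_left_lt].
  have ep0 := eps_gt0 lam0 m00 e0s.
  pose s := (1 - e / es) `^ q^-1.
  have s0 : 0 < s by rewrite powR_gt0.
  have sq : s `^ q = 1 - e / es by rewrite -powRrM mulVf ?gt_eqF// powRr1// ltW.
  have sd : s < Num.min d (1 - a).
    have : 1 - e / es < Num.min d (1 - a) `^ q.
      near: e; move/cvgr_lt: eps0; apply.
      by rewrite powR_gt0// lt_min d0 subr_gt0.
    rewrite -sq; apply: contraTT; rewrite -!leNgt => h.
    apply: ge0_ler_powR => //; rewrite ?nnegrE ?(ltW q0) ?(ltW s0)//.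
    by rewrite le_min (ltW d0) subr_ge0 ltW.
  move: sd; rewrite lt_min => /andP[sd sa].
  have -> : (1 + c) `^ (p - 1) * ((1 - e / es) `^ b)^-1 =
      ((1 + c) * (1 - e / es)) `^ (p - 1) * s.
    rewrite powRM ?(ltW ep0) ?addr_ge0 ?(ltW c0)// -mulrA; congr (_ * _).
    rewrite -powRN /s -powRD; last by rewrite (gt_eqF ep0) implybT.
    by congr (_ `^ _); rewrite /b; ring.
  apply: (@Kbar1_lower a) => //.
  + by case: La => /andP[].
  + by rewrite -lerBrDl ltW.
  move=> x /andP[ax xas].
  have xa : `|x - a| <= s by rewrite ger0_norm ?subr_ge0// lerBlDl.
  apply: le_trans (H e x _ _) _.
  + by case/andP: e0s => -> /ltW.
  + exact: le_lt_trans sd.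
  rewrite mulrDl mul1r lerD2l ler_wpM2l ?(ltW c0)// -sq.
  by apply: ge0_ler_powR => //; rewrite ?nnegrE ?(ltW q0) ?(ltW s0).
- apply: gt0_cvgMry; first by rewrite powR_gt0// addr_gt0.
  apply: (cvgrVy _).2.
    near=> e; rewrite powR_gt0// (eps_gt0 lam0 m00)//.
    by apply/andP; split; near: e; [exact: nbhs_left_ge|exact: nbhs_left_lt].
  exact: (cvg_comp _ _ epsc (powR_cvg0 b0)).
Unshelve. all: by end_near. Qed.
End minima.

(** * The clock: eta as a function of time *)
Section clock.
Context (R : realType) (g : R -> R).
Local Notation mu := (@lebesgue_measure R).
Implicit Types x y s t : R.
Hypothesis gc : continuous g.
Hypothesis g0 : forall x, 0 < g x.

(** Starting from -1 makes the clock differentiable at 0, where eta starts. *)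
Definition clock x : R := \int[mu]_(y in `[-1, x]) g y.

Let gint a b : mu.-integrable `[a, b] (EFin \o g).
Proof.
apply: continuous_compact_integrable; first exact: segment_compact.
exact: continuous_subspaceT.
Qed.

Lemma is_derive_clock x : -1 < x -> is_derive x 1 clock (g x).
Proof.
move=> x1.
have [|d <-] :=
  @continuous_FTC1_closed _ g (-1) x (x + 1) _ (gint _ _) x1 (@gc x).
- by rewrite ltrDl.
by rewrite derive1E; exact: derivableP.
Qed.

Lemma clock_continuous x : -1 < x -> {for x, continuous clock}.
Proof.
move=> /is_derive_clock[d _]; apply: differentiable_continuous.
exact/derivable1_diffP.
Qed.

Lemma clock_lt x y : -1 < x -> x < y -> clock x < clock y.
Proof.
move=> x1 xy.
have [||c _ h] := @MVT _ clock g x y xy.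
- move=> z; rewrite in_itv/= => /andP[xz _]; apply: is_derive_clock; exact: lt_trans xz.
- apply: continuous_in_subspaceT => z; rewrite inE/= in_itv/= => /andP[xz _].
  by apply: clock_continuous; exact: lt_le_trans xz.
by rewrite -subr_gt0 h mulr_gt0// subr_gt0.
Qed.

Lemma clock_diff x : 0 <= x -> \int[mu]_(y in `[0, x]) g y = clock x - clock 0.
Proof.
move=> x0; rewrite /clock.
have := @Rintegral_itvB _ g (BLeft (-1)) (BRight x) 0 (gint _ _).
rewrite !bnd_simp => -> //.
  rewrite Rintegral_itv_obnd_cbnd//.
  by apply: integrableS (gint 0 x) => //; apply: subset_itvr; rewrite bnd_simp.
Qed.

Lemma clock_limit (es : R) : 0 < es ->
  \int[mu]_(y in `[0, e]) g y @[e --> es^'-] --> clock es - clock 0.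
Proof.
move=> es0; apply: (@cvg_trans _ ((clock e - clock 0) @[e --> es^'-])).
  apply: near_eq_cvg; near=> e; rewrite clock_diff//.
  by near: e; exact: nbhs_left_ge.
apply: cvg_at_left_filter; apply: cvgB; last exact: cvg_cst.
by apply: clock_continuous; rewrite (lt_trans _ es0)// oppr_lt0.
Unshelve. all: by end_near. Qed.

Variables (es : R) (eta w : R -> R).
Hypothesis es0 : 0 < es.
Let T := clock es - clock 0.
Hypothesis eta0 : eta t @[t --> (0 : R)^'+] --> (0 : R).
Hypothesis w0 : forall t, 0 <= w t.
Hypothesis etaw : forall t, 0 < t < T -> is_derive t (1 : R) eta (w t).
Hypothesis wE : forall t, 0 < t < T -> 0 <= eta t -> w t = (g (eta t))^-1.
Hypothesis etalt : forall t, 0 < t < T -> eta t < es.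

Lemma clock_time_gt0 : 0 < T.
Proof. by rewrite subr_gt0 clock_lt// oppr_lt0. Qed.

Let eta_within s t : 0 < s -> t < T -> {within `[s, t], continuous eta}.
Proof.
move=> s0 tT; apply: continuous_in_subspaceT => z; rewrite inE/= in_itv/= => /andP[sz zt].
have [d _] : is_derive z 1 eta (w z).
  by apply: etaw; rewrite (lt_le_trans s0)// (le_lt_trans zt).
by apply: differentiable_continuous; exact/derivable1_diffP.
Qed.

Lemma eta_nondecreasing s t : 0 < s -> s < t -> t < T -> eta s <= eta t.
Proof.
move=> s0 st tT; have [||c _ h] := @MVT _ eta w s t st.
- move=> z; rewrite in_itv/= => /andP[sz zt].
  by apply: etaw; rewrite (lt_trans s0)// (lt_trans zt).
- exact: eta_within.
by rewrite -subr_ge0 h mulr_ge0// subr_ge0 ltW.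
Qed.

(** The equation for eta can be compared with the clock only where eta >= 0;
    this follows from monotonicity alone, as the right-hand side is nonnegative
    whatever eta is. *)
Lemma eta_ge0 t : 0 < t < T -> 0 <= eta t.
Proof.
move=> /andP[t0 tT]; rewrite leNgt; apply/negP => et.
suff : \forall s \near (0 : R)^'+, False by move=> /filter_ex[].
near=> s.
have h1 : eta t < eta s by near: s; exact: (cvgr_gt 0 eta0).
have : eta s <= eta t.
  by apply: eta_nondecreasing.
by rewrite leNgt h1.
Unshelve. all: by end_near. Qed.

Let m1 : (-1 : R) < 0. Proof. by rewrite oppr_lt0. Qed.

(** The derivative of the clock along eta is 1 by separation of variables. *)
Lemma clock_eta t : 0 < t < T -> clock (eta t) - clock 0 = t.
Proof.
move=> /andP[t0 tT]; apply/eqP; rewrite subr_eq addrC -subr_eq; apply/eqP.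
have der z : 0 < z < T -> is_derive z 1 (clock \o eta) 1.
  move=> zT; have ez := eta_ge0 zT.
  have h := is_derive1_comp (is_derive_clock (lt_le_trans m1 ez)) (etaw zT).
  by apply: (is_derive_eq h); rewrite wE// mulfV// gt_eqF.
have const s : 0 < s -> s < t -> clock (eta s) - s = clock (eta t) - t.
  move=> s0 st; have [||c _ /= h] := @MVT _ (clock \o eta) (cst 1) s t st.
  - move=> z; rewrite in_itv/= => /andP[sz zt].
    by apply: der; rewrite (lt_trans s0)// (lt_trans zt).
  - apply: continuous_in_subspaceT => z; rewrite inE/= in_itv/= => /andP[sz zt].
    have [d _] : is_derive z 1 (clock \o eta) 1.
      by apply: der; rewrite (lt_le_trans s0)// (le_lt_trans zt).
    by apply: differentiable_continuous; exact/derivable1_diffP.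
  by move: h; rewrite mul1r; lra.
have l1 : (clock (eta s) - s) @[s --> (0 : R)^'+] --> clock (eta t) - t.
  by apply: cvg_near_cst; near=> s; apply: const.
have l2 : (clock (eta s) - s) @[s --> (0 : R)^'+] --> clock 0.
  rewrite -[X in _ --> X]subr0; apply: cvgB; last exact: cvg_within.
  by apply: (cvg_comp _ _ eta0); exact: clock_continuous.
by apply: (cvg_unique _ l1 l2); exact: Rhausdorff.
Unshelve. all: by end_near. Qed.

(** If e < es then clock e - clock 0 < T, so that clock (eta t) > clock e, hence
    eta t > e, for t close to T. *)
Lemma eta_cvg_left : eta t @[t --> T^'-] --> es^'-.
Proof.
have T0 := clock_time_gt0.
have h : eta t @[t --> T^'-] --> es.
  apply/cvgrPdist_lt => d d0.
  pose e := Num.max 0 (es - d).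
  have e0 : 0 <= e by rewrite le_max lexx.
  have ees : e < es by rewrite gt_max es0 gtrBl.
  near=> t.
  have tT : 0 < t < T.
    by apply/andP; split; near: t; [exact: nbhs_left_gt|exact: nbhs_left_lt].
  rewrite ger0_norm ?subr_ge0 ?(ltW (etalt tT))//.
  suff : e < eta t by rewrite gt_max => /andP[_]; rewrite ltrBlDr ltrBlDl.
  have : clock e - clock 0 < t.
    by near: t; apply: nbhs_left_gt; rewrite ltrD2r clock_lt// (lt_le_trans m1).
  rewrite -{1}(clock_eta tT) ltrD2r; apply: contraTT; rewrite -!leNgt.
  rewrite le_eqVlt => /predU1P[->//|h]; apply/ltW/clock_lt => //.
  exact: lt_le_trans (eta_ge0 tT).
move=> A A0; have := h _ A0; rewrite /nbhs /= => hh.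
near=> t; suff : eta t < es by near: t.
by apply: etalt; apply/andP; split; near: t; [exact: nbhs_left_gt|exact: nbhs_left_lt].
Unshelve. all: by end_near. Qed.
End clock.

(** * The slope as a function of eta and the label *)

(** In the next three inequalities G is the factor in front of the bracket of
    u_x and Gs its negative limit; k1 and k0 are the moments, j is 1/J. *)
Lemma profile_min_le (R : realFieldType) (G Gs eps k1 k0 : R) :
  0 < eps -> Gs < 0 -> G <= Gs / 2 -> eps * k1 / k0 <= 2^-1 ->
  G * (eps^-1 - k1 / k0) <= (Gs / 4) * eps^-1.
Proof.
move=> ep0 g0 ge rh.
have -> : eps^-1 - k1 / k0 = (1 - eps * k1 / k0) * eps^-1.
  by rewrite mulrBl mul1r; congr (_ - _); rewrite [RHS]mulrC -mulrA mulKf// gt_eqF.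
rewrite mulrA; apply: ler_wpM2r; first by rewrite invr_ge0 ltW.
move: (eps * k1 / k0) rh => r rh.
have h1 : 0 <= (Gs / 2 - G) * (1 - r) by rewrite mulr_ge0 ?subr_ge0//; lra.
have h2 : 0 <= - Gs * (2^-1 - r) by rewrite mulr_ge0 ?subr_ge0// oppr_ge0 ltW.
by lra.
Qed.

Lemma profile_other_ge (R : realFieldType) (G Gs A B j c : R) :
  Gs < 0 -> G <= Gs / 2 -> A <= B -> 2 * c <= A -> j <= c -> 0 <= c ->
  - Gs / 4 * A <= G * (j - B).
Proof.
move=> g0 ge AB cA jc c0.
have h : - Gs / 2 * (A / 2) <= - G * (B - j).
  by apply: ler_pM; lra.
by lra.
Qed.

Lemma profile_abs_le (R : realFieldType) (G Gs j c k1 C k0 k : R) :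
  2 * Gs <= G -> G < 0 -> 0 <= j <= c -> 0 <= k1 <= C -> k / 2 <= k0 -> 0 < k ->
  `|G * (j - k1 / k0)| <= - (2 * Gs) * (c + C * (2 / k)).
Proof.
move=> ge gn /andP[j0 jc] /andP[k10 kC] kk k_gt0.
have k00 : 0 < k0 by apply: lt_le_trans kk; rewrite divr_gt0.
rewrite normrM; apply: ler_pM => //; first by rewrite ltr0_norm// lerN2.
apply: (le_trans (ler_normB _ _)).
rewrite ger0_norm// lerD// ger0_norm; last by rewrite divr_ge0// ltW.
apply: ler_pM => //; first by rewrite invr_ge0 ltW.
by rewrite -[2 / _]invf_div lef_pV2 ?posrE// divr_gt0.
Qed.

Section profile.
Context (R : realType) (lambda m0 M0 : R) (u0 du0 : R -> R).
Hypotheses (H : initial_data u0 du0 M0 m0) (lam0 : lambda < 0).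
Local Notation mu := (@lebesgue_measure R).
Local Notation es := (eta_star lambda m0).
Local Notation J := (calJ lambda du0).
Local Notation K0 := (Kbar lambda du0 0).
Local Notation K1 := (Kbar lambda du0 1).
Local Notation p := (- lambda^-1).
Implicit Types (e x a : R).

Let m00 : m0 < 0. Proof. by case/andP: (extrema_sign H). Qed.
Let M00 : 0 < M0. Proof. by case/andP: (extrema_sign H). Qed.
Let bnd := du0_bounds H.
Let es0 : 0 < es. Proof. exact: eta_star_gt0. Qed.

Let K0_cvg : K0 e @[e --> es^'-] --> K0 es.
Proof.
have [E [mE _ mdu _ EI]] := good_labels H.
exact: (Kbar0_cvg lam0 m00 M00 bnd mE mdu EI).
Qed.

Let K0_gt0 e : 0 <= e <= es -> 0 < K0 e.
Proof.
have [E [mE _ mdu Egt EI]] := good_labels H.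
exact: (Kbar0_gt0 lam0 m00 M00 bnd mE mdu Egt EI).
Qed.

Let K0_le e : 0 <= e <= es -> K0 e <= Jtop m0 M0 `^ p.
Proof.
have [E [mE _ mdu Egt EI]] := good_labels H.
exact: (Kbar0_le lam0 m00 M00 bnd mE mdu EI).
Qed.

Let eK1_cvg : ((1 - e / es) * K1 e) @[e --> es^'-] --> 0.
Proof.
have [E [mE _ mdu Egt EI]] := good_labels H.
exact: (eps_Kbar1_cvg lam0 m00 M00 bnd mE mdu EI).
Qed.

(** The maximum with [Kmin] is inactive on the range of eta and makes the
    integrand of the clock positive and continuous on R. *)
Lemma characteristic_clock :
  exists T0 : R, [/\ 0 < T0, blowup_time lambda du0 m0 T0 &
  forall T, blowup_time lambda du0 m0 T -> T = T0 /\
    forall s : char_solution lambda u0 du0 m0 T, eta s t @[t --> T^'-] --> es^'-].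
Proof.
have [E [mE _ mdu Egt EI]] := good_labels H.
have kmin0 := Kmin_gt0 lam0 m00 bnd mE mdu Egt EI.
pose k e := Num.max (Kmin lambda m0 du0 E) (Kext lambda du0 E e).
pose g e := k e `^ (2 * lambda).
have mx0 e : 0 < k e.
  by rewrite /k lt_max; apply/orP; left; exact: kmin0.
have g0 e : 0 < g e by rewrite powR_gt0.
have gc : continuous g.
  move=> e; apply: (@continuous_comp _ _ _ k (fun y => y `^ (2 * lambda))).
    apply: continuous_max; first exact: cvg_cst.
    exact: (Kext_continuous lam0 m00 M00 bnd mE mdu EI).
  exact: powR_cvg.
have gE e : 0 <= e <= es -> g e = K0 e `^ (2 * lambda).
  move=> he; have ge := Kbar0_ge lam0 m00 M00 bnd mE mdu EI he.
  by rewrite /g /k (Kext_eq lam0 m00 bnd EI he) (max_r ge).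
have BT : blowup_time lambda du0 m0 (clock g es - clock g 0).
  apply: cvg_trans (clock_limit gc es0).
  apply: near_eq_cvg; near=> e.
  have ees : e <= es by near: e; exact: nbhs_left_le.
  apply: eq_Rintegral => y.
  by rewrite inE/= in_itv/= => /andP[y0 ye]; rewrite gE// y0 (le_trans ye).
exists (clock g es - clock g 0); split => //.
  exact: clock_time_gt0.
move=> T hT.
have TE : T = clock g es - clock g 0.
  by apply: (cvg_unique _ hT BT); exact: Rhausdorff.
split => // s; rewrite TE in hT s *.
apply: (@eta_cvg_left _ g gc g0 es _ (fun t => K0 (eta s t) `^ (- (2 * lambda)))) => //.
- exact: eta_cont0 s.
- by move=> t; exact: powR_ge0.
- by move=> t; exact: eta_ode s t.
- move=> t /andP[t0 tT] e0; rewrite gE ?powRN//.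
  by rewrite e0 ltW// eta_lt// (ltW t0).
- by move=> t /andP[t0 tT]; rewrite eta_lt// (ltW t0).
Unshelve. all: by end_near. Qed.

Definition gain e : R := (lambda * e * K0 e `^ (2 * lambda))^-1.

Definition profile e x : R := gain e * ((J e x)^-1 - K1 e / K0 e).

Let near_es : \forall e \near es^'-, 0 < e < es.
Proof.
near=> e; apply/andP; split; near: e; [exact: nbhs_left_gt|exact: nbhs_left_lt].
Unshelve. all: by end_near. Qed.

Lemma gain_lt0 e : 0 < e <= es -> gain e < 0.
Proof.
move=> /andP[e0 ee]; rewrite /gain invr_lt0 nmulr_rlt0 ?nmulr_rlt0//.
by rewrite powR_gt0// K0_gt0// (ltW e0).
Qed.

Lemma gain_cvg : gain e @[e --> es^'-] --> gain es.
Proof.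
apply: cvgV.
  by rewrite -invr_eq0 -/(gain es) lt_eqF// gain_lt0// es0 lexx.
apply: cvgM.
  by apply: cvgMr; exact: cvg_within.
apply: (@cvg_comp _ _ _ K0 (fun y => y `^ (2 * lambda)) _ _ _ K0_cvg); apply: powR_cvg.
by rewrite K0_gt0// (ltW es0) lexx.
Qed.

(** The factor is negative, whence the order of the two bounds. *)
Lemma gain_near : \forall e \near es^'-, 2 * gain es <= gain e <= gain es / 2.
Proof.
have g0 : gain es < 0 by rewrite gain_lt0// es0 lexx.
near=> e; apply/andP; split; near: e.
  by apply: (cvgr_ge (gain es) gain_cvg); lra.
by apply: (cvgr_le (gain es) gain_cvg); lra.
Unshelve. all: by end_near. Qed.

(** Factoring out 1/eps leaves the bracket 1 - eps K_1/K_0, which tends to 1. *)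
Lemma profile_min_cvg a : du0 a = m0 -> profile e a @[e --> es^'-] --> -oo.
Proof.
move=> am; have g0 : gain es < 0 by rewrite gain_lt0// es0 lexx.
have r0 : ((1 - e / es) * K1 e / K0 e) @[e --> es^'-] --> 0.
  have -> : 0 = 0 * (K0 es)^-1 :> R by rewrite mul0r.
  apply: cvgM; first exact: eK1_cvg.
  by apply: cvgV K0_cvg; rewrite gt_eqF// K0_gt0// (ltW es0) lexx.
apply: (@ler_cvgNy _ _ _ _ (fun e => (- gain es / 4) * (- (1 - e / es))^-1)).
  near=> e.
  have e0s : 0 < e < es by near: e; exact: near_es.
  have e0s' : 0 <= e < es by case/andP: e0s => /ltW -> ->.
  have ep0 := eps_gt0 lam0 m00 e0s'.
  have ge : gain e <= gain es / 2.
    by have /andP[] : 2 * gain es <= gain e <= gain es / 2 by near: e; exact: gain_near.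
  have rh : (1 - e / es) * K1 e / K0 e <= 2^-1.
    by near: e; apply: (cvgr_le 0 r0); rewrite invr_gt0 ltr0n.
  rewrite /profile (calJ_min lam0 m00 e am).
  rewrite [leRHS](_ : _ = (gain es / 4) * (1 - e / es)^-1); last first.
    by rewrite invrN !mulNr mulrN opprK.
  exact: profile_min_le.
apply: gt0_cvgMrNy; first by rewrite divr_gt0 ?oppr_gt0// ltr0n.
apply: (cvgrVNy _).2.
  near=> e; rewrite oppr_lt0 (eps_gt0 lam0 m00)//.
  have /andP[/ltW -> ->//] : 0 < e < es by near: e; exact: near_es.
rewrite -[X in _ --> X]oppr0; apply: cvgN.
by apply: cvg_trans (eps_cvg lam0 m00) _; exact: cvg_within.
Unshelve. all: by end_near. Qed.

Let starmin x : m0 < du0 x -> 0 < Num.min 1 (J es x).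
Proof.
move=> h; rewrite lt_min ltr01 (calJ_star _ lam0 m00) divr_gt0// ?subr_gt0//.
by rewrite oppr_gt0.
Qed.

Lemma calJV_bound e x : 0 <= e <= es -> m0 < du0 x ->
  0 <= (J e x)^-1 <= (Num.min 1 (J es x))^-1.
Proof.
move=> he hx; have h := calJ_ge_min du0 lam0 m00 x he.
rewrite invr_ge0 (calJ_ge0 lam0 m00 bnd)//=.
by rewrite lef_pV2 ?posrE ?starmin// (lt_le_trans (starmin hx)).
Qed.

Lemma profile_bounded x (C : R) : m0 < du0 x ->
  (\forall e \near es^'-, K1 e <= C) ->
  exists B : R, \forall e \near es^'-, `|profile e x| <= B.
Proof.
move=> hx K1C; have g0 : gain es < 0 by rewrite gain_lt0// es0 lexx.
have k0 : 0 < K0 es by rewrite K0_gt0// (ltW es0) lexx.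
exists (- (2 * gain es) * ((Num.min 1 (J es x))^-1 + C * (2 / K0 es))); near=> e.
have e0s : 0 < e < es by near: e; exact: near_es.
have e0s' : 0 <= e <= es by case/andP: e0s => /ltW -> /ltW ->.
have ge : 2 * gain es <= gain e.
  by have /andP[] : 2 * gain es <= gain e <= gain es / 2 by near: e; exact: gain_near.
have gn : gain e < 0 by rewrite gain_lt0//; case/andP: e0s => -> /ltW ->.
have K1C' : 0 <= K1 e <= C by rewrite Kbar1_ge0/=; near: e.
have kk : K0 es / 2 <= K0 e.
  by near: e; apply: (cvgr_ge (K0 es) K0_cvg); lra.
exact: (profile_abs_le ge gn (calJV_bound e0s' hx) K1C' kk k0).
Unshelve. all: by end_near. Qed.

Lemma profile_cvgy x : m0 < du0 x -> K1 e @[e --> es^'-] --> +oo ->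
  profile e x @[e --> es^'-] --> +oo.
Proof.
move=> hx K1y; have g0 : gain es < 0 by rewrite gain_lt0// es0 lexx.
pose c := (Num.min 1 (J es x))^-1.
pose k := Jtop m0 M0 `^ p.
have k0 : 0 < k by rewrite powR_gt0// (lt_le_trans ltr01)// Jtop_ge1.
apply: (@ger_cvgy _ _ _ _ (fun e => (- gain es / 4) * (k^-1 * K1 e))).
  near=> e.
  have e0s : 0 < e < es by near: e; exact: near_es.
  have e0s' : 0 <= e <= es by case/andP: e0s => /ltW -> /ltW ->.
  have ge : gain e <= gain es / 2.
    by have /andP[] : 2 * gain es <= gain e <= gain es / 2 by near: e; exact: gain_near.
  have /andP[j0 j1] := calJV_bound e0s' hx.
  have Kk : K1 e / k <= K1 e / K0 e.
    by rewrite ler_wpM2l ?Kbar1_ge0// lef_pV2 ?posrE ?K0_gt0// K0_le.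
  have cK : 2 * c <= K1 e / k.
    by rewrite ler_pdivlMr//; near: e; move/cvgryPge: K1y; exact.
  rewrite [k^-1 * _]mulrC; apply: (profile_other_ge g0 ge Kk cK j1).
  exact: le_trans j1.
apply: gt0_cvgMry; first by rewrite divr_gt0 ?oppr_gt0// ltr0n.
by apply: gt0_cvgMry; rewrite ?invr_gt0.
Unshelve. all: by end_near. Qed.

Lemma jacobian_cvg x : J e x `^ p / K0 e @[e --> es^'-] --> J es x `^ p / K0 es.
Proof.
have p0 := p_gt0 lam0.
have k0 : 0 < K0 es by rewrite K0_gt0// (ltW es0) lexx.
apply: cvgM; last by apply: cvgV K0_cvg; rewrite gt_eqF.
have js e : 0 <= e <= es -> Num.max (J e x) 0 = J e x.
  by move=> h; rewrite max_l// (calJ_ge0 lam0 m00 bnd).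
rewrite -(js es) ?(ltW es0) ?lexx//.
apply: (@cvg_trans _ (Num.max (J e x) 0 `^ p @[e --> es^'-])).
  apply: near_eq_cvg; near=> e; rewrite js//.
  have /andP[/ltW -> /ltW ->//] : 0 < e < es by near: e; exact: near_es.
apply: cvg_at_left_filter.
apply: (@continuous_comp _ _ _ (fun e => J e x) (fun y => Num.max y 0 `^ p)).
  apply: continuousB; first exact: cvg_cst.
  apply: continuousM; last exact: cvg_cst.
  by apply: continuousM; [exact: cvg_cst|exact: cvg_id].
exact: max0_powR_continuous.
Unshelve. all: by end_near. Qed.

(** As [gain] is negative, u_x increases with J, hence with u0': the extrema
    of u_x are attained at those of u0'. *)
Lemma profile_ge e x a : 0 < e < es -> du0 a = m0 -> profile e a <= profile e x.
Proof.
move=> e0s am; have e0s' : 0 <= e < es by case/andP: e0s => /ltW -> ->.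
have e0s2 : 0 < e <= es by case/andP: e0s => -> /ltW ->.
rewrite /profile ler_nM2l ?gain_lt0// lerD2r lef_pV2 ?posrE ?(calJ_gt0 lam0 m00 bnd)//.
rewrite (calJ_min lam0 m00 e am) (calJ_ge_eps lam0 m00 bnd)//.
by case/andP: e0s => /ltW -> /ltW ->.
Qed.

Lemma profile_le e x a : 0 < e < es -> du0 a = M0 -> profile e x <= profile e a.
Proof.
move=> e0s am; have e0s' : 0 <= e < es by case/andP: e0s => /ltW -> ->.
have e0s2 : 0 < e <= es by case/andP: e0s => -> /ltW ->.
rewrite /profile ler_nM2l ?gain_lt0// lerD2r lef_pV2 ?posrE ?(calJ_gt0 lam0 m00 bnd)//.
rewrite /calJ am lerD2l lerN2 ler_wnM2l//; last by case/andP: (bnd x).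
by rewrite nmulr_rle0// ltW//; case/andP: e0s.
Qed.
End profile.

(** * Solutions along characteristics *)
Lemma bounded_near_le (R : realType) (T : Type) (F : set_system T) {FF : Filter F}
  (f : T -> R) (B : R) : (\forall x \near F, `|f x| <= B) -> bounded_near f F.
Proof.
move=> fB; rewrite /bounded_near; near=> M; apply: filterS fB => x fxB.
by apply: (le_trans fxB); near: M; apply: nbhs_pinfty_ge; exact: num_real.
Unshelve. all: by end_near. Qed.

Lemma near_comp (X Y : Type) (f : X -> Y) (F : set_system X) (G : set_system Y)
  (Q : set Y) : f @ F --> G -> (\forall y \near G, Q y) -> \forall x \near F, Q (f x).
Proof. by move=> h /h. Qed.

Section solution.
Context (R : realType) (lambda m0 M0 T : R) (u0 du0 : R -> R).
Hypotheses (H : initial_data u0 du0 M0 m0) (lam0 : lambda < 0).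
Hypothesis hT : blowup_time lambda du0 m0 T.
Variable s : char_solution lambda u0 du0 m0 T.
Local Notation es := (eta_star lambda m0).
Local Notation K1 := (Kbar lambda du0 1).
Local Notation profile := (profile lambda du0).
Implicit Types (x a : R).

Let m00 : m0 < 0. Proof. by case/andP: (extrema_sign H). Qed.
Let bnd := du0_bounds H.

Lemma eta_cvg : 0 < T /\ eta s t @[t --> T^'-] --> es^'-.
Proof.
have [T0 [T00 _ h]] := characteristic_clock H lam0; have [TE hs] := h _ hT.
by split; [rewrite TE|exact: hs].
Qed.

Lemma near_eta : \forall t \near T^'-, 0 < t < T /\ 0 < eta s t < es.
Proof.
have [T0 he] := eta_cvg; have es0 := eta_star_gt0 lam0 m00.
have hes : \forall e \near es^'-, 0 < e < es.
  near=> e; apply/andP; split; near: e; [exact: nbhs_left_gt|exact: nbhs_left_lt].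
near=> t; split; last by near: t; exact: (he _ hes).
by apply/andP; split; near: t; [exact: nbhs_left_gt|exact: nbhs_left_lt].
Unshelve. all: by end_near. Qed.

Lemma slope_profile : \forall t \near T^'-,
  0 < eta s t < es /\ forall x, ux s (gam s x t) t = profile (eta s t) x.
Proof.
by apply: filterS near_eta => t [tT es_]; split => // x; exact: ux_gamE.
Qed.

Lemma slope_near (P : set R) x :
  (\forall e \near es^'-, P (profile e x)) ->
  \forall t \near T^'-, P (ux s (gam s x t) t).
Proof.
have [_ he] := eta_cvg => h.
have {}h : \forall t \near T^'-, P (profile (eta s t) x) .
  exact: (@near_comp _ _ (eta s) _ _ (fun e => P (profile e x)) he h).
by apply: filterS2 slope_profile h => t [_ ->].
Qed.

Lemma slope_cvg (F : set_system R) x : profile e x @[e --> es^'-] --> F ->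
  ux s (gam s x t) t @[t --> T^'-] --> F.
Proof. by move=> h A /h; exact: slope_near. Qed.

Lemma mmin_slope a : level_points du0 m0 a ->
  \forall t \near T^'-, ux s (gam s a t) t = mmin s t.
Proof.
move=> [a01 am]; apply: filterS slope_profile => t [et uE].
have lb x : profile (eta s t) a <= profile (eta s t) x by exact: (profile_ge H lam0).
apply/eqP; rewrite eq_le; apply/andP; split.
  rewrite uE; apply: lb_le_inf; last by move=> _ [x _ <-]; rewrite uE.
  by exists (ux s (gam s a t) t), a.
apply: ge_inf; last by exists a.
by exists (profile (eta s t) a) => _ [x _ <-]; rewrite uE.
Qed.

Lemma Mmax_slope a : level_points du0 M0 a ->
  \forall t \near T^'-, ux s (gam s a t) t = Mmax s t.
Proof.
move=> [a01 am]; apply: filterS slope_profile => t [et uE].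
have ub x : profile (eta s t) x <= profile (eta s t) a by exact: (profile_le H lam0).
apply/eqP; rewrite eq_le; apply/andP; split.
  apply: ub_le_sup; last by exists a.
  by exists (profile (eta s t) a) => _ [x _ <-]; rewrite uE.
rewrite uE; apply: ge_sup; last by move=> _ [x _ <-]; rewrite uE.
by exists (ux s (gam s a t) t), a.
Qed.

Let above x : 0 <= x <= 1 -> ~ level_points du0 m0 x -> m0 < du0 x.
Proof.
move=> x01 nx; have /andP[h _] := bnd x; rewrite lt_neqAle h andbT.
by apply/eqP => e; apply: nx.
Qed.

Let M0_above a : level_points du0 M0 a -> m0 < du0 a.
Proof. by move=> [_ ->]; case/andP: (extrema_sign H) => h1 h2; exact: lt_trans h2. Qed.

Lemma mmin_cvgNy : mmin s t @[t --> T^'-] --> -oo.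
Proof.
have [a La] := min_attained H.
apply: cvg_trans (slope_cvg (profile_min_cvg H lam0 La.2)).
by apply: near_eq_cvg; exact: mmin_slope.
Qed.

Lemma one_sided_blowup (C : R) : (\forall e \near es^'-, K1 e <= C) ->
  one_sided_discrete_blowup s.
Proof.
move=> K1C; split.
- exact: mmin_cvgNy.
- by move=> a [_ am]; apply/slope_cvg/(profile_min_cvg H lam0).
- move=> x x01 /(above x01) hx; have [B hB] := profile_bounded H lam0 hx K1C.
  by apply: (@bounded_near_le _ _ _ _ _ B); exact: (@slope_near (fun y => `|y| <= B)).
- have [a La] := max_attained H.
  have [B hB] := profile_bounded H lam0 (M0_above La) K1C.
  apply: (@bounded_near_le _ _ _ _ _ B).
  have h := @slope_near (fun y => `|y| <= B) _ hB.
  near=> t; have <- : ux s (gam s a t) t = Mmax s t by near: t; exact: Mmax_slope.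
  by near: t.
Unshelve. all: by end_near. Qed.

Lemma two_sided_blowup : K1 e @[e --> es^'-] --> +oo ->
  two_sided_everywhere_blowup s M0.
Proof.
move=> K1y; split.
- have [a La] := max_attained H.
  apply: cvg_trans (slope_cvg (profile_cvgy H lam0 (M0_above La) K1y)).
  by apply: near_eq_cvg; exact: Mmax_slope.
- exact: mmin_cvgNy.
- move=> x x01 _ /(above x01) hx; apply: slope_cvg.
  exact: (profile_cvgy H lam0 hx).
Qed.

Lemma jacobian_limits : jacobian_limit s.
Proof.
have [T0 he] := eta_cvg; have p0 := p_gt0 lam0; have es0 := eta_star_gt0 lam0 m00.
pose L x := calJ lambda du0 es x `^ (- lambda^-1) / Kbar lambda du0 0 es.
have cv x : gam_alpha s x t @[t --> T^'-] --> L x.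
  apply: (@cvg_trans _ ((calJ lambda du0 (eta s t) x `^ (- lambda^-1) /
     Kbar lambda du0 0 (eta s t)) @[t --> T^'-])).
    apply: near_eq_cvg; apply: filterS near_eta => t [/andP[t0 tT] _].
    by rewrite gam_alphaE// (ltW t0).
  pose j e := calJ lambda du0 e x `^ (- lambda^-1) / Kbar lambda du0 0 e.
  exact: (@cvg_comp _ _ _ (eta s) j _ _ _ he (jacobian_cvg H lam0 (x := x))).
move=> x x01; split.
  move=> [_ xm]; have := cv x; rewrite /L (calJ_min lam0 m00 es xm).
  by rewrite divff ?gt_eqF// subrr powR0 ?gt_eqF// mul0r.
move=> /(above x01) hx; exists (L x); last exact: cv.
have [E [mE _ mdu Egt EI]] := good_labels H; have /andP[_ M00] := extrema_sign H.
apply: divr_gt0; last first.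
  by apply: (Kbar0_gt0 lam0 m00 M00 bnd mE mdu Egt EI); rewrite (ltW es0) lexx.
by rewrite powR_gt0// (calJ_star _ lam0 m00) divr_gt0 ?subr_gt0// oppr_gt0.
Qed.
End solution.

(** * Parameter ranges *)
Section ranges.
Context (R : realType) (lambda q C2 M0 m0 : R) (u0 du0 : R -> R).
Hypotheses (hq : 0 < q) (hC2 : 0 < C2) (H : initial_data u0 du0 M0 m0).
Hypothesis hmin : forall a, level_points du0 m0 a -> power_min_at du0 m0 C2 q a.
Local Notation es := (eta_star lambda m0).
Local Notation K1 := (Kbar lambda du0 1).
Local Notation p := (- lambda^-1).

Let m00 : m0 < 0. Proof. by case/andP: (extrema_sign H). Qed.
Let M00 : 0 < M0. Proof. by case/andP: (extrema_sign H). Qed.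
Let bnd := du0_bounds H.

Lemma Kbar1_near_bounded : lambda < 0 -> 1 <= p \/ (p < 1 /\ q * (1 - p) < 1) ->
  exists C : R, \forall e \near es^'-, K1 e <= C.
Proof.
move=> lam0 hp; have es0 := eta_star_gt0 lam0 m00.
have [E [mE E01 mdu Egt EI]] := good_labels H.
case: hp => [p1|[p1 qp1]].
  exists (Jtop m0 M0 `^ (p - 1)); near=> e.
  apply: (Kbar1_le_large_p lam0 m00 M00 bnd mE mdu EI) => //.
  by apply/andP; split; near: e; [exact: nbhs_left_ge|exact: nbhs_left_lt].
have [C HC] := Kbar1_le_small_p lam0 m00 M00 hq hC2 bnd mE E01 mdu EI
  (min_finite H) (min_attained H) (min_isolated H) hmin p1 qp1.
exists C; near=> e; apply: HC; apply/andP; split; near: e.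
  by apply: nbhs_left_ge; rewrite ltr_pdivrMr// ltr_pMr// ltr1n.
exact: nbhs_left_lt.
Unshelve. all: by end_near. Qed.

(** By periodicity 0 is a minimum if 1 is, so some minimum has room to its right. *)
Lemma Kbar1_near_infinity : lambda < 0 -> p < 1 -> 1 < q * (1 - p) ->
  K1 e @[e --> es^'-] --> +oo.
Proof.
move=> lam0 p1 qp1; have [E [mE E01 mdu Egt EI]] := good_labels H.
have [a La a1] : exists2 a, level_points du0 m0 a & a < 1.
  have [a La] := min_attained H; have [a1|a1] := ltP a 1; first by exists a.
  exists 0; last exact: ltr01.
  case: La => /andP[_ a1'] am; split; first by rewrite lexx ler01.
  by rewrite -(du0_periodic H) add0r -am; congr du0; apply/eqP; rewrite eq_le a1 a1'.
exact: (Kbar1_cvgy lam0 m00 M00 hq hC2 bnd mE mdu EI hmin La).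
Qed.

Lemma p_lt1 : lambda < -1 -> p < 1.
Proof.
move=> l1; have l0 : lambda < 0 by rewrite (lt_trans l1)// oppr_lt0.
by rewrite -invrN invf_lt1 ?oppr_gt0// ltrNr.
Qed.

Let opp_ratio : - (q / (1 - q)) = q / (q - 1).
Proof. by rewrite -mulrN -invrN opprB. Qed.

Lemma part1_exponent : part1_range lambda q -> lambda < 0 /\ 1 <= p.
Proof.
move=> [/andP[l1 l0] _]; split => //.
by rewrite -invrN invf_ge1 ?oppr_gt0// lerNl.
Qed.

(** For q < 1 the claim is q (1 - p) < q < 1; for q > 1 the
    inequality q / (1 - q) < lambda is q (1 - p) < 1 itself. *)
Lemma part2_exponent : part2_range lambda q \/ part2_range_large_q lambda q ->
  [/\ lambda < 0, p < 1 & q * (1 - p) < 1].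
Proof.
case=> [[l1 /andP[_ q1] _]|[/andP[ql l1] q1]];
  have l0 : lambda < 0 by rewrite (lt_trans l1)// oppr_lt0.
  split => //; first exact: p_lt1.
  rewrite -[ltRHS]mul1r; apply: ltr_pM => //; first exact: ltW.
    by rewrite subr_ge0 ltW// p_lt1.
  by rewrite gtrBl p_gt0.
split => //; first exact: p_lt1.
have {}ql : - lambda < q / (q - 1) by rewrite -opp_ratio ltrN2.
rewrite ltr_pdivlMr ?subr_gt0// in ql.
have -> : q * (1 - p) = q - q / (- lambda) by field; rewrite lt_eqF.
by rewrite ltrBlDl -ltrBlDr ltr_pdivlMr ?oppr_gt0// mulrC.
Qed.

Lemma part3_exponent : part3_range lambda q ->
  [/\ lambda < 0, p < 1 & 1 < q * (1 - p)].
Proof.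
move=> [lq q1]; have qm : 0 < q - 1 by rewrite subr_gt0.
have {}lq : q / (q - 1) < - lambda by rewrite -opp_ratio ltrN2.
rewrite ltr_pdivrMr// in lq.
have l1 : lambda < -1.
  rewrite -ltrN2 opprK -(ltr_pM2r qm) mul1r; apply: lt_trans lq.
  by rewrite gtrBl.
have l0 : lambda < 0 by rewrite (lt_trans l1)// oppr_lt0.
split => //; first exact: p_lt1.
have -> : q * (1 - p) = q - q / (- lambda) by field; rewrite lt_eqF.
by rewrite ltrBrDl -ltrBrDr ltr_pdivrMr ?oppr_gt0// mulrC.
Qed.
End ranges.

Theorem theorem3p99 (R : realType) (lambda q C2 M0 m0 : R) (u0 du0 : R -> R)
  (hq : 0 < q) (hC2 : 0 < C2)
  (hdata : initial_data u0 du0 M0 m0)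
  (hmin : forall a, level_points du0 m0 a -> power_min_at du0 m0 C2 q a) :
  [/\ part1_range lambda q ->
        exists T : R, [/\ 0 < T, blowup_time lambda du0 m0 T &
          forall s : char_solution lambda u0 du0 m0 T,
            one_sided_discrete_blowup s],
      part2_range lambda q \/ part2_range_large_q lambda q ->
        exists T : R, [/\ 0 < T, blowup_time lambda du0 m0 T &
          forall s : char_solution lambda u0 du0 m0 T,
            one_sided_discrete_blowup s],
      part3_range lambda q ->
        exists T : R, [/\ 0 < T, blowup_time lambda du0 m0 T &
          forall s : char_solution lambda u0 du0 m0 T,
            two_sided_everywhere_blowup s M0] &
      [\/ part1_range lambda q, part2_range lambda q, part2_range_large_q lambda q | part3_range lambda q] ->
        forall T : R, blowup_time lambda du0 m0 T ->
          forall s : char_solution lambda u0 du0 m0 T, jacobian_limit s].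
Proof.
have clk l0 := characteristic_clock (lambda := lambda) hdata l0.
split.
- move=> /part1_exponent[l0 p1]; have [T [T0 hT _]] := clk l0.
  exists T; split => // s.
  have [|C K1C] := Kbar1_near_bounded hq hC2 hdata hmin l0; first by left.
  exact: (one_sided_blowup hdata l0 hT s K1C).
- move=> /(part2_exponent hq)[l0 p1 qp]; have [T [T0 hT _]] := clk l0.
  exists T; split => // s.
  have [|C K1C] := Kbar1_near_bounded hq hC2 hdata hmin l0; first by right.
  exact: (one_sided_blowup hdata l0 hT s K1C).
- move=> /part3_exponent[l0 p1 qp]; have [T [T0 hT _]] := clk l0.
  exists T; split => // s; apply: (two_sided_blowup hdata l0 hT).
  exact: (Kbar1_near_infinity hq hC2 hdata hmin).
- move=> hr T hT s; apply: (jacobian_limits hdata _ hT).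
  case: hr => [/part1_exponent[]//|h|h|/part3_exponent[]//].
    by have [] := part2_exponent hq (or_introl h).
  by have [] := part2_exponent hq (or_intror h).
Qed.
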